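(* Let $k\ge 1$ be an integer, let $f_1,f_2,f_3,f_4\in\mathbb{C}[x_1,x_2,x_3]$ be general forms of degree $3$, and let $R_{3,3,k}=\mathbb{C}[x_1,x_2,x_3]/(f_1,f_2,f_3,f_4)^k$. Then the Hilbert series of $R_{3,3,k}$ is $$\sum_{i=0}^{3k-1}\binom{i+2}{2}t^i+(27k-56)t^{3k}\qquad\text{when } 9\le k\le 40,$$ and $$\left[\frac{(1-t^{3k})^{\binom{k+3}{3}}}{(1-t)^3}\right]\qquad\text{when } k<9.$$
   Context: A form is a homogeneous polynomial. ''General forms'' means: the statement holds for all $(f_1,\dots,f_4)$ in some nonempty Zariski-open subset (depending on $k$) of the space of $4$-tuples of forms of degree $3$ in $\mathbb{C}[x_1,x_2,x_3]$. The Hilbert series of a graded algebra $R=\bigoplus_i R_i$ is $\sum_i \dim_{\mathbb{C}}(R_i)\,t^i$. For a power series $\sum_{i\ge0}a_it^i$ with integer coefficients, $\left[\sum_{i\ge0}a_it^i\right]$ denotes its truncation before the first nonpositive term, i.e. $\sum_{i<m}a_it^i$, where $m$ is the smallest index with $a_m\le 0$ (and the whole series if no such $m$ exists). *)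

(* Defs.v *)
From HB Require Import structures.
From mathcomp Require Import all_boot all_order all_algebra.
From mathcomp Require Import generic_quotient ring_quotient.
From mathcomp Require Import boolp reals.
From mathcomp Require Import complex.
From mathcomp Require Import mpoly.

Set Implicit Arguments.
Unset Strict Implicit.
Unset Printing Implicit Defensive.

Import GRing.Theory Num.Theory.

Local Open Scope ring_scope.
Local Open Scope quotient_scope.

Section IdealPowers.
Variable A : comNzRingType.
Implicit Types (S I J : A -> Prop) (k : nat).

Definition ideal_span S (p : A) : Prop :=
  exists n (a g : 'I_n -> A),
    (forall i, S (g i)) /\ p = \sum_(i < n) a i * g i.

Definition ideal_prod I J : A -> Prop :=
  ideal_span (fun p => exists x y, [/\ I x, J y & p = x * y]).

Definition ideal_pow I k : A -> Prop :=
  iter k (ideal_prod I) (fun=> True).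

Lemma ideal_span_sub S I :
    I 0 -> (forall a u v, I u -> I v -> I (a * u + v)) ->
  (forall x, S x -> I x) -> forall x, ideal_span S x -> I x.
Proof.
move=> I0 IS SI x [n [a [g [Sg ->]]]]; elim/big_ind: _ => //.
- by move=> u v Iu Iv; rewrite -[u]mul1r; apply: IS.
- by move=> i _; rewrite -[_ * _]addr0; apply: IS => //; apply: SI.
Qed.

Lemma ideal_span0 S : ideal_span S 0.
Proof.
by exists 0, (fun=> 0), (fun=> 0); split; [case|rewrite big_ord0].
Qed.

Lemma ideal_span_linear S a u v :
  ideal_span S u -> ideal_span S v -> ideal_span S (a * u + v).
Proof.
move=> [m [b [g [Sg ->]]]] [n [c [h [Sh ->]]]].
exists (m + n)%N.
exists (fun i => match split i with inl j => a * b j | inr j => c j end).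
exists (fun i => match split i with inl j => g j | inr j => h j end).
split=> [i|]; first by case: (split i) => j.
rewrite big_split_ord /= mulr_sumr; congr (_ + _); apply: eq_bigr => i _.
  by rewrite (unsplitK (inl i)) mulrA.
by rewrite (unsplitK (inr i)).
Qed.

End IdealPowers.

Section FormsIdeal.
Variables (K : fieldType) (n d r : nat).

Definition forms_ideal (f : {ffun 'I_r -> dhomog n K d}) :
    {mpoly K[n]} -> Prop :=
  ideal_span (fun p : {mpoly K[n]} => exists j, p = f j).

(* The quotient rings of the library are nontrivial, so the ideal must be     *)
(* proved proper; hence the assumptions 0 < d and 0 < k.                      *)
Definition forms_ideal_pow (d_gt0 : (0 < d)%N)
    (f : {ffun 'I_r -> dhomog n K d}) (k : nat) (k_gt0 : (0 < k)%N) :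
    {pred {mpoly K[n]}} :=
  fun p => `[< ideal_pow (forms_ideal f) k p >].

Variable d_gt0 : (0 < d)%N.

Lemma forms_ideal_at0 (f : {ffun 'I_r -> dhomog n K d}) p :
  forms_ideal f p -> p.@[fun=> 0] = 0.
Proof.
move: p; apply: ideal_span_sub.
- by rewrite meval0.
- by move=> a u v /= u0 v0; rewrite mevalD mevalM u0 v0 mulr0 addr0.
move=> _ [j ->]; rewrite mevalE big_seq big1 // => m fm.
have /dhomogP/(_ m fm) degm := dhomog_is_dhomog (f j).
suff [i mi] : exists i, (0 < m i)%N.
  by rewrite (bigD1 i) //= expr0n eqn0Ngt mi mul0r mulr0.
apply/existsP; apply: contraTT d_gt0; rewrite negb_exists => /forallP m0.
rewrite -degm [_ m]mdegE big1 // => i _.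
by apply/eqP; rewrite eqn0Ngt m0.
Qed.

Lemma forms_ideal_pow_closed f k (k_gt0 : (0 < k)%N) :
  idealr_closed (forms_ideal_pow d_gt0 f k_gt0).
Proof.
case: k k_gt0 => // k k_gt0; split.
- by apply/asboolP; apply: ideal_span0.
- apply/asboolP => /= p1; have := oner_neq0 K.
  rewrite -(meval1 (fun _ : 'I_n => 0)); apply/negP; rewrite negbK; apply/eqP.
  move: {1 2}1 p1; apply: ideal_span_sub.
  + by rewrite meval0.
  + by move=> a u v /= u0 v0; rewrite mevalD mevalM u0 v0 mulr0 addr0.
  + by move=> _ [x [y [/forms_ideal_at0 x0 _ ->]]]; rewrite mevalM x0 mul0r.
- move=> a u v /asboolP uI /asboolP vI; apply/asboolP.
  exact: ideal_span_linear.
Qed.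

HB.instance Definition _ f k (k_gt0 : (0 < k)%N) :=
  isIdealr.Build {mpoly K[n]} (forms_ideal_pow d_gt0 f k_gt0)
    (forms_ideal_pow_closed f k_gt0).

End FormsIdeal.

Section QuotientAlgebra.
Variables (K : fieldType) (n : nat) (J : idealr {mpoly K[n]}).

Definition quot_alg : Type := {ideal_quot J}.
HB.instance Definition _ := GRing.ComNzRing.on quot_alg.

Definition quot_proj (p : {mpoly K[n]}) : quot_alg := \pi_{ideal_quot J} p.

Definition quot_scale (c : K) (x : quot_alg) : quot_alg := quot_proj c%:MP * x.

Lemma quot_projM p q : quot_proj (p * q) = quot_proj p * quot_proj q.
Proof. exact: rmorphM. Qed.

Lemma quot_projD p q : quot_proj (p + q) = quot_proj p + quot_proj q.
Proof. exact: rmorphD. Qed.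

Lemma quot_scaleA a b x : quot_scale a (quot_scale b x) = quot_scale (a * b) x.
Proof. by rewrite /quot_scale mpolyCM quot_projM mulrA. Qed.

Lemma quot_scale1 : left_id 1 quot_scale.
Proof.
move=> x; rewrite /quot_scale mpolyC1.
suff -> : quot_proj 1 = 1 by rewrite mul1r.
exact: rmorph1.
Qed.

Lemma quot_scaleDr : right_distributive quot_scale +%R.
Proof. by move=> a x y; rewrite /quot_scale mulrDr. Qed.

Lemma quot_scaleDl x : {morph quot_scale^~ x : a b / a + b}.
Proof. by move=> a b; rewrite /quot_scale mpolyCD quot_projD mulrDl. Qed.

HB.instance Definition _ := GRing.Zmodule_isLmodule.Build K quot_alg
  quot_scaleA quot_scale1 quot_scaleDr quot_scaleDl.

Definition graded_piece (i : nat) (x : quot_alg) : Prop :=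
  exists2 p : {mpoly K[n]}, p \is i.-homog & x = quot_proj p.

End QuotientAlgebra.

(* Intended for a predicate W that is a linear subspace of V.                 *)
Definition has_dimension (K : fieldType) (V : lmodType K) (W : V -> Prop)
    (m : nat) : Prop :=
  exists b : 'I_m -> V,
    [/\ forall i, W (b i),
        forall c : 'I_m -> K, \sum_i c i *: b i = 0 -> forall i, c i = 0
      & forall x, W x -> exists c : 'I_m -> K, x = \sum_i c i *: b i].

(* Formal power series over the integers are represented by their sequences   *)
(* of coefficients.                                                           *)
Definition series_of_poly (p : {poly int}) : nat -> int := fun i => p`_i.

Definition series_mul (a b : nat -> int) : nat -> int :=
  fun i => \sum_(j < i.+1) a j * b (i - j)%N.

Definition series_exp (a : nat -> int) (m : nat) : nat -> int :=
  iter m (series_mul a) (series_of_poly 1).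

(* 1 / (1 - t), see geometric_seriesP.                                        *)
Definition geometric_series : nat -> int := fun=> 1.

Lemma geometric_seriesP :
  series_mul (series_of_poly (1 - 'X)) geometric_series =1 series_of_poly 1.
Proof.
move=> i; rewrite /series_mul /series_of_poly /geometric_series.
rewrite big_ord_recl coefB coef1 coefX /= subr0 mulr1.
case: i => [|i]; first by rewrite big_ord0 addr0 coef1.
rewrite big_ord_recl coefB coef1 coefX /= big1 => [|j _].
  by rewrite addr0 mulr1 coef1 sub0r subrr.
by rewrite coefB coef1 coefX /= subrr mul0r.
Qed.

(* Truncation before the first nonpositive coefficient.                       *)
Definition series_trunc (a : nat -> int) : nat -> int :=
  fun i => if [forall j : 'I_i.+1, 0 < a j] then a i else 0.

Definition has_hilbert_series (K : fieldType) (n : nat)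
    (J : idealr {mpoly K[n]}) (s : nat -> int) : Prop :=
  forall i, exists2 m : nat,
    has_dimension (@graded_piece K n J i) m & s i = m%:Z.

Section Zariski.
Variables (K : fieldType) (V : vectType K).

Definition zariski_closed (Z : V -> Prop) : Prop :=
  exists E : {mpoly K[\dim {:V}]} -> Prop,
    forall v, Z v <->
      (forall g, E g -> g.@[fun i => coord (vbasis {:V}) i v] = 0).

Definition zariski_open (U : V -> Prop) : Prop :=
  zariski_closed (fun v => ~ U v).

Definition for_general (P : V -> Prop) : Prop :=
  exists U : V -> Prop,
    [/\ zariski_open U, exists v, U v & forall v, U v -> P v].

End Zariski.

(* Main.v *)
(* Write I for the ideal of the four forms and V_d for the space of forms of
   degree d. Each condition below holds on an open set, which is nonempty because
   the condition holds for one explicit quadruple x^3, y^3, z^3, g.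

   If I contains V_5 (take g = xyz), then I V_d = V_(d+3) for d >= 2; hence I^k
   contains V_(3k+2), and as soon as I^4 contains V_13, I^k contains V_(3k+1) for
   all k >= 4. There are 105 products f^a x_i with |a| = 4, and dim V_13 = 105:
   so spanning V_13 also means that these products are independent, and then so
   are the products f^a x_i with |a| = k for every k <= 4, as one sees on
   multiplying a relation by a power of f_1. For a suitable g this is an
   invertible integer matrix.

   In degree 3k, the monomials f^a with a_4 <= 8 form a basis of (I^k)_(3k).
   They are independent for g = xy^2 + yz^2, which has nine distinct conjugates
   when the variables are multiplied by cube roots of unity, so that a relation
   would be a polynomial of degree at most 8 in g with nine roots. They span
   because the forms of degree divisible by 3 are generated by nine elements as a
   module over the polynomials in f_1, f_2, f_3, so that the Cayley-Hamilton
   theorem makes f_4 integral of degree 9 over these polynomials. *)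

From Stdlib Require Import Ascii String.
From HB Require Import structures.
Require Import Defs.
From mathcomp Require Import all_boot all_order all_algebra.
From mathcomp Require Import generic_quotient boolp.
From mathcomp Require Import ring_quotient reals complex mpoly.
From mathcomp Require Import zify ring.

Set Implicit Arguments.
Unset Strict Implicit.
Unset Printing Implicit Defensive.

Import GRing.Theory Num.Theory.

Local Open Scope ring_scope.

(** * Generic conditions on the points of a vector space *)

Section PolynomialFunctions.
Variables (K : numFieldType) (V : vectType K).
Implicit Types (f g : V -> K) (P Q : V -> Prop).

Definition polyfun f : Prop :=
  exists q : {mpoly K[\dim {:V}]},
    forall v, f v = q.@[fun i => coord (vbasis {:V}) i v].

Lemma eq_polyfun f g : f =1 g -> polyfun g -> polyfun f.
Proof. by move=> fg [q qE]; exists q => v; rewrite fg. Qed.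

Lemma polyfun_const c : polyfun (fun=> c).
Proof. by exists c%:MP => v; rewrite mevalC. Qed.

Lemma polyfunD f g : polyfun f -> polyfun g -> polyfun (fun v => f v + g v).
Proof. by move=> [p pE] [q qE]; exists (p + q) => v; rewrite mevalD pE qE. Qed.

Lemma polyfunM f g : polyfun f -> polyfun g -> polyfun (fun v => f v * g v).
Proof. by move=> [p pE] [q qE]; exists (p * q) => v; rewrite mevalM pE qE. Qed.

Lemma polyfun_sum I (r : seq I) (A : pred I) (F : I -> V -> K) :
    (forall i, polyfun (F i)) ->
  polyfun (fun v => \sum_(i <- r | A i) F i v).
Proof.
move=> pF; elim: r => [|i r IH].
  by apply: eq_polyfun (polyfun_const 0) => v; rewrite big_nil.
case Ai: (A i); last by apply: eq_polyfun IH => v; rewrite big_cons Ai.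
by apply: eq_polyfun (polyfunD (pF i) IH) => v; rewrite big_cons Ai.
Qed.

Lemma polyfun_prod I (r : seq I) (A : pred I) (F : I -> V -> K) :
    (forall i, polyfun (F i)) ->
  polyfun (fun v => \prod_(i <- r | A i) F i v).
Proof.
move=> pF; elim: r => [|i r IH].
  by apply: eq_polyfun (polyfun_const 1) => v; rewrite big_nil.
case Ai: (A i); last by apply: eq_polyfun IH => v; rewrite big_cons Ai.
by apply: eq_polyfun (polyfunM (pF i) IH) => v; rewrite big_cons Ai.
Qed.

Lemma polyfun_scalar (f : {scalar V}) : polyfun f.
Proof.
exists (\sum_(i < \dim {:V}) f (vbasis {:V})`_i *: 'X_i) => v.
rewrite raddf_sum {1}(coord_vbasis (memvf v)) linear_sum /=.
by apply: eq_bigr => i _; rewrite linearZ /= mevalZ mevalXU mulrC.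
Qed.

Lemma polyfun_det n (A : V -> 'M[K]_n) :
  (forall i j, polyfun (fun v => A v i j)) -> polyfun (fun v => \det (A v)).
Proof.
move=> pA; apply: polyfun_sum => s; apply: polyfunM; first exact: polyfun_const.
by apply: polyfun_prod => i; apply: pA.
Qed.

Lemma polyfun_line f v w : polyfun f ->
  exists p : {poly K}, forall t, f (v + t *: w) = p.[t].
Proof.
case=> q qE; pose c u i := coord (vbasis {:V}) i u.
exists (mmap polyC (fun i => (c v i)%:P + c w i *: 'X) q) => t.
rewrite qE -[RHS]/(horner_eval t _) /mmap mevalE rmorph_sum /=.
apply: eq_bigr => m _; rewrite rmorphM /= /horner_eval hornerC; congr (_ * _).
rewrite /mmap1 -[RHS]/(horner_eval t _) rmorph_prod; apply: eq_bigr => i _.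
rewrite rmorphXn /= /horner_eval hornerD hornerC hornerZ hornerX.
by rewrite /c linearD linearZ /= mulrC.
Qed.

(** A nonempty basic open set, cut out by one polynomial function: conjunctions then reduce to
    products of functions, and one nonzero value is a witness of nonemptiness. *)
Definition generic P : Prop :=
  exists f, [/\ polyfun f, exists v, f v != 0 & forall v, f v != 0 -> P v].

Lemma generic_imply P Q : (forall v, P v -> Q v) -> generic P -> generic Q.
Proof.
by move=> PQ [f [pf nf fP]]; exists f; split=> // v fv; apply/PQ/fP.
Qed.

(** In characteristic 0 the elements 0, 1, 2, ... are distinct, and [size p] of them are too many to
    be all roots. *)
Lemma poly_nonroot (p : {poly K}) : p != 0 -> exists t, p.[t] != 0.
Proof.
move=> p0; pose s := [seq (i%:R : K) | i <- iota 0 (size p)].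
have us : uniq s.
  by rewrite map_inj_uniq ?iota_uniq // => i j /eqP; rewrite eqr_nat => /eqP.
have : ~~ all (root p) s.
  apply/negP=> /(max_poly_roots p0)/(_ us).
  by rewrite size_map size_iota ltnn.
by case/allPn=> t _; exists t.
Qed.

(* Both functions restrict to nonzero polynomials on the line through two points
   where they do not vanish. *)
Lemma genericI P Q : generic P -> generic Q -> generic (fun v => P v /\ Q v).
Proof.
move=> [f [pf [v fv] fP]] [g [pg [w gw] gQ]].
exists (fun v => f v * g v); split; first exact: polyfunM.
  have [p pE] := polyfun_line v (w - v) pf.
  have [q qE] := polyfun_line v (w - v) pg.
  have p0 : p != 0.
    by apply: contraNneq fv => p0; rewrite -[v]addr0 -(scale0r (w - v)) pE p0 horner0.
  have q0 : q != 0.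
    apply: contraNneq gw => q0; rewrite -[w](subrK v) addrC -[w - v]scale1r.
    by rewrite qE q0 horner0.
  have [t] := poly_nonroot (mulf_neq0 p0 q0); rewrite hornerM -pE -qE => nt.
  by exists (v + t *: (w - v)).
by move=> u; rewrite mulf_eq0 negb_or => /andP[/fP Pu /gQ].
Qed.

Lemma for_general_generic P : generic P -> for_general P.
Proof.
case=> f [[q qE] [v fv] fP]; exists (fun v => f v != 0); split=> //; last by exists v.
(* The complement of the open set is the zero locus of the single equation [q]. *)
exists (fun p => p = q) => w; split=> [/negP|E].
  by rewrite negbK => /eqP + p -> => <-; rewrite qE.
by apply/negP; rewrite negbK qE (E _ erefl).
Qed.

(** Semicontinuity of the rank. One-sided inverses [B] and [C] of the factors in a full rank
    factorization of [A v0] make [B *m A v0 *m C] the identity of size r. The determinant of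
    [B *m A v *m C] is thus a nonzero polynomial function of [v], and where it does not vanish the
    rank is at least r. *)
Lemma generic_rank m n (A : V -> 'M[K]_(m, n)) (v0 : V) :
    (forall i j, polyfun (fun v => A v i j)) ->
  generic (fun v => (\rank (A v0) <= \rank (A v))%N).
Proof.
move=> pA; set r := \rank (A v0).
pose B : 'M_(r, m) := pinvmx (col_base (A v0)).
pose C : 'M_(n, r) := pinvmx (row_base (A v0)).
exists (fun v => \det (B *m A v *m C)); split.
- apply: polyfun_det => i j.
  apply: (@eq_polyfun _ (fun v => \sum_k (\sum_l B i l * A v l k) * C k j)) => [v|].
    by rewrite !mxE; apply: eq_bigr => k _; rewrite mxE.
  apply: polyfun_sum => k; apply: polyfunM; last exact: polyfun_const.
  by apply: polyfun_sum => l; apply: polyfunM; first exact: polyfun_const.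
- exists v0; rewrite -[A v0]mulmx_base mulmxA mulVpmx ?col_base_full // mul1mx.
  by rewrite mulmxVp ?row_base_free // det1 oner_neq0.
move=> v; rewrite -unitfE -unitmxE => /mxrank_unit <-.
by apply: leq_trans (mxrankM_maxl _ _) _; apply: mxrankM_maxr.
Qed.

End PolynomialFunctions.

(** * Families of homogeneous polynomials *)

Definition monomial n d : finType :=
  seq_sub [seq s2m (val t) | t <- enum (basis n d)].

Lemma mdeg_monomial n d (m : monomial n d) : mdeg (val m) = d.
Proof. by apply/eqP; rewrite basis_cover; apply: valP. Qed.

Lemma monomialP n d m : mdeg m = d -> exists x : monomial n d, m = val x.
Proof. by move/eqP; rewrite basis_cover => mb; exists (SeqSub mb). Qed.

Lemma card_monomial n d : #|{: monomial n.+1 d}| = 'C(d + n, n).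
Proof.
by rewrite card_seq_sub ?uniq_basis // size_basis -bin_sub ?leq_addr // addKn.
Qed.

Section Families.
Variables (K : fieldType) (V : lmodType K).

Definition in_span (I : finType) (u : I -> V) (v : V) : Prop :=
  exists c : I -> K, v = \sum_i c i *: u i.

Definition free_family (I : finType) (u : I -> V) : Prop :=
  forall c : I -> K, \sum_i c i *: u i = 0 -> forall i, c i = 0.

Variables (I J : finType) (u : I -> V) (w : J -> V).

Lemma in_span_mem i : in_span u (u i).
Proof.
exists (fun j => (j == i)%:R); rewrite (bigD1 i) //= eqxx scale1r big1 ?addr0 //.
by move=> j /negbTE->; rewrite scale0r.
Qed.

Lemma in_span0 : in_span u 0.
Proof. by exists (fun=> 0); rewrite big1 // => i _; rewrite scale0r. Qed.

Lemma in_spanD x y : in_span u x -> in_span u y -> in_span u (x + y).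
Proof.
move=> [a ->] [b ->]; exists (fun i => a i + b i); rewrite -big_split /=.
by apply: eq_bigr => i _; rewrite scalerDl.
Qed.

Lemma in_spanZ c x : in_span u x -> in_span u (c *: x).
Proof.
move=> [a ->]; exists (fun i => c * a i); rewrite scaler_sumr.
by apply: eq_bigr => i _; rewrite scalerA.
Qed.

Lemma in_span_sum T (r : seq T) (A : pred T) (F : T -> V) :
  (forall i, A i -> in_span u (F i)) -> in_span u (\sum_(i <- r | A i) F i).
Proof. by move=> uF; elim/big_ind: _ => //; [exact: in_span0|exact: in_spanD]. Qed.

End Families.

Section HomogeneousFamilies.
Variables (K : fieldType) (n d : nat).
Local Notation P := {mpoly K[n]}.
Local Notation M := (monomial n d).
Implicit Types (p q : P).

Lemma homog_sum_monomial p : p \is d.-homog ->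
  p = \sum_(m : M) p@_(val m) *: 'X_[val m].
Proof.
move=> hp; apply/mpolyP => m; rewrite raddf_sum /=.
have [dm|/eqP dm] := eqVneq (mdeg m) d; last first.
  rewrite (dhomog_nemf_coeff hp) ?big1 //; last exact/eqP.
  move=> x _; rewrite mcoeffZ mcoeffX; case: eqP => [xm|_]; last by rewrite mulr0.
  by case: dm; rewrite -xm mdeg_monomial.
have [x ->] := monomialP dm.
rewrite (bigD1 x) //= mcoeffZ mcoeffX eqxx mulr1 big1 ?addr0 // => y yx.
by rewrite mcoeffZ mcoeffX (inj_eq val_inj) (negbTE yx) mulr0.
Qed.

Lemma homog_ind (A : P -> Prop) :
    A 0 -> (forall p q, A p -> A q -> A (p + q)) ->
    (forall c p, A p -> A (c *: p)) ->
    (forall m, mdeg m = d -> A 'X_[m]) ->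
  forall p, p \is d.-homog -> A p.
Proof.
move=> A0 AD AZ AX p /homog_sum_monomial->; elim/big_ind: _ => // m _.
exact/AZ/AX/mdeg_monomial.
Qed.

Definition coef_row p : 'rV[K]_#|{: M}| := \row_j p@_(val (enum_val j)).

Lemma coef_row_inj p q :
  p \is d.-homog -> q \is d.-homog -> coef_row p = coef_row q -> p = q.
Proof.
move=> hp hq /rowP pq; rewrite (homog_sum_monomial hp) (homog_sum_monomial hq).
apply: eq_bigr => m _; congr (_ *: _).
by have := pq (enum_rank m); rewrite !mxE enum_rankK.
Qed.

Variable I : finType.
Implicit Types u : I -> P.

Definition coef_mx u : 'M[K]_(#|I|, #|{: M}|) :=
  \matrix_(i, j) (u (enum_val i))@_(val (enum_val j)).

Definition family_rank u : nat := \rank (coef_mx u).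

Lemma coef_row_sum u (c : I -> K) :
  coef_row (\sum_i c i *: u i) = (\row_i c (enum_val i)) *m coef_mx u.
Proof.
apply/rowP => j; rewrite !mxE raddf_sum /= (reindex_onto enum_val enum_rank) /=.
  apply: eq_big => [i|i _]; first by rewrite enum_valK eqxx.
  by rewrite !mxE mcoeffZ.
by move=> i _; rewrite enum_rankK.
Qed.

Variable u : I -> P.
Hypothesis uh : forall i, u i \is d.-homog.

Lemma homog_comb (c : I -> K) : \sum_i c i *: u i \is d.-homog.
Proof. by apply: rpred_sum => i _; apply/rpredZ/uh. Qed.

Lemma in_spanP p : p \is d.-homog ->
  in_span u p <-> (coef_row p <= coef_mx u)%MS.
Proof.
move=> hp; split=> [[c ->]|/submxP[D DE]].
  by rewrite coef_row_sum submxMl.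
exists (fun i => D 0 (enum_rank i)); apply: coef_row_inj => //.
  exact: homog_comb.
rewrite DE coef_row_sum; congr (_ *m _).
by apply/rowP => i; rewrite mxE enum_valK.
Qed.

Lemma free_familyP : free_family u <-> family_rank u = #|I|.
Proof.
split=> [uf|/eqP uf c c0 i].
  apply/eqP; change (row_free (coef_mx u)); rewrite -kermx_eq0; apply/rowV0P => v.
  move/sub_kermxP => v0; apply/rowP => i; rewrite mxE.
  rewrite -(enum_valK i); apply: (uf (fun j => v 0 (enum_rank j))).
  apply: coef_row_inj; rewrite ?homog_comb ?rpred0 // coef_row_sum.
  transitivity (v *m coef_mx u).
    by congr (_ *m _); apply/rowP => j; rewrite mxE enum_valK.
  by rewrite v0; apply/rowP => j; rewrite !mxE mcoeff0.
have: (\row_i c (enum_val i)) *m coef_mx u = 0 *m coef_mx u.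
  by rewrite -coef_row_sum c0 mul0mx; apply/rowP => j; rewrite !mxE mcoeff0.
by move/(row_free_inj uf)/rowP/(_ (enum_rank i)); rewrite !mxE enum_rankK.
Qed.

Lemma span_allP :
  (forall p, p \is d.-homog -> in_span u p) <-> family_rank u = #|{: M}|.
Proof.
split=> [us|/eqP us p hp].
  apply/eqP; change (row_full (coef_mx u)); rewrite -sub1mx; apply/row_subP => j.
  have hX : 'X_[K, val (enum_val j)] \is d.-homog.
    by rewrite dhomogX; apply/eqP/mdeg_monomial.
  suff -> : row j 1%:M = coef_row 'X_[K, val (enum_val j)] by apply/in_spanP/us.
  apply/rowP => k; rewrite !mxE mcoeffX (inj_eq val_inj) (inj_eq enum_val_inj).
  by rewrite eq_sym.
by apply/in_spanP => //; apply: submx_full.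
Qed.

Lemma family_rank_le_card : (family_rank u <= #|I|)%N.
Proof. exact: rank_leq_row. Qed.

Lemma family_rank_le_monomial : (family_rank u <= #|{: M}|)%N.
Proof. exact: rank_leq_col. Qed.

End HomogeneousFamilies.

Lemma family_rank_span (K : fieldType) n d (I J : finType)
    (u : I -> {mpoly K[n]}) (w : J -> {mpoly K[n]}) :
    (forall i, u i \is d.-homog) -> (forall j, w j \is d.-homog) ->
    (forall i, in_span w (u i)) ->
  (family_rank d u <= family_rank d w)%N.
Proof.
move=> uh wh wu; apply: mxrankS; apply/row_subP => i.
suff -> : row i (coef_mx d u) = coef_row d (u (enum_val i)) by apply/in_spanP.
by apply/rowP => j; rewrite !mxE.
Qed.

(** * Graded pieces of a quotient *)

Section GradedQuotient.
Variables (K : fieldType) (n d : nat) (J : idealr {mpoly K[n]}).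
Local Notation P := {mpoly K[n]}.
Local Notation M := (monomial n d).

Definition row_poly (v : 'rV[K]_#|{: M}|) : P :=
  \sum_j v 0 j *: 'X_[val (enum_val j)].

Lemma row_poly_homog v : row_poly v \is d.-homog.
Proof.
apply: rpred_sum => j _; apply: rpredZ.
by rewrite dhomogX; apply/eqP/mdeg_monomial.
Qed.

Lemma row_polyK : cancel row_poly (@coef_row K n d).
Proof.
move=> v; apply/rowP => j; rewrite mxE raddf_sum /= (bigD1 j) //=.
rewrite mcoeffZ mcoeffX eqxx mulr1 big1 ?addr0 // => i ij.
by rewrite mcoeffZ mcoeffX (inj_eq val_inj) (inj_eq enum_val_inj) (negbTE ij) mulr0.
Qed.

Lemma coef_rowK p : p \is d.-homog -> row_poly (coef_row d p) = p.
Proof.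
by move=> hp; apply: (coef_row_inj (row_poly_homog _) hp); rewrite row_polyK.
Qed.

Lemma row_poly_linear : linear row_poly.
Proof.
move=> c v w; rewrite /row_poly scaler_sumr -big_split /=.
by apply: eq_bigr => j _; rewrite !mxE scalerDl scalerA.
Qed.
HB.instance Definition _ := GRing.isLinear.Build K _ _ _ row_poly row_poly_linear.

Lemma quot_proj_eq (p q : P) : (quot_proj J p == quot_proj J q) = (p - q \in J).
Proof. by rewrite Quotient.idealrBE. Qed.

Lemma quot_proj0 : quot_proj J 0 = 0.
Proof. by apply: (addrI (quot_proj J 0)); rewrite -quot_projD !addr0. Qed.

Lemma quot_projZ c (p : P) : quot_proj J (c *: p) = c *: quot_proj J p.
Proof. by rewrite -mul_mpolyC quot_projM. Qed.

Lemma quot_proj_sum I (r : seq I) (A : pred I) (F : I -> P) :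
  quot_proj J (\sum_(i <- r | A i) F i) = \sum_(i <- r | A i) quot_proj J (F i).
Proof. exact: (raddf_sum (\pi_{ideal_quot J})%qT). Qed.

(** The part of [J] in degree d is the row space of the coefficient matrix of [u]. A complement of
    that row space meets [J] only in 0 and represents every class, so a basis of it projects to a
    basis of the graded piece. *)
Lemma graded_dimension (I : finType) (u : I -> P) :
    (forall i, u i \is d.-homog) ->
    (forall p, p \is d.-homog -> p \in J <-> in_span u p) ->
  has_dimension (@graded_piece K n J d) (#|{: M}| - family_rank d u).
Proof.
move=> uh uJ; set A := coef_mx d u; rewrite /family_rank -/A -mxrank_compl.
set B := (A^C)%MS; pose e i := row_poly (row i (row_base B)).
have comb (c : 'I_(\rank B) -> K) :
    \sum_i c i *: e i = row_poly ((\row_i c i) *m row_base B).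
  rewrite mulmx_sum_row linear_sum; apply: eq_bigr => i _.
  by rewrite mxE linearZ.
exists (fun i => quot_proj J (e i)); split.
- by move=> i; exists (e i) => //; apply: row_poly_homog.
- move=> c c0 i; set v := (\row_i c i) *m row_base B.
  have : quot_proj J (row_poly v) == quot_proj J 0.
    rewrite -comb quot_proj_sum quot_proj0; apply/eqP; apply: etrans c0.
    by apply: eq_bigr => j _; rewrite quot_projZ.
  rewrite quot_proj_eq subr0 => /(uJ _ (row_poly_homog _)).
  move/(in_spanP uh (row_poly_homog _)); rewrite row_polyK => vA.
  have vB : (v <= B)%MS by rewrite (submx_trans (submxMl _ _)) ?eq_row_base.
  have : (v <= A :&: B)%MS by rewrite sub_capmx vA.
  rewrite capmx_compl submx0 => /eqP v0.
  have : v = 0 *m row_base B by rewrite mul0mx.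
  by move/(row_free_inj (row_base_free B))/rowP/(_ i); rewrite !mxE.
move=> _ [p hp ->].
have : (coef_row d p <= A + B)%MS by rewrite submx_full ?addsmx_compl_full.
case/sub_addsmxP => -[v1 v2] /= vE.
have /submxP[c cE] : (v2 *m B <= row_base B)%MS by rewrite eq_row_base submxMl.
exists (fun i => c 0 i); apply/eqP.
have -> : \sum_i c 0 i *: quot_proj J (e i) = quot_proj J (row_poly (v2 *m B)).
  rewrite cE -[c in RHS](_ : \row_i c 0 i = c); last first.
    by apply/rowP => i; rewrite mxE.
  by rewrite -comb quot_proj_sum; apply: eq_bigr => i _; rewrite quot_projZ.
rewrite quot_proj_eq -[p]coef_rowK // vE linearD addrK.
apply/(uJ _ (row_poly_homog _))/(in_spanP uh (row_poly_homog _)).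
by rewrite row_polyK submxMl.
Qed.

End GradedQuotient.

(** * Powers of the ideal of a family of forms *)

Lemma mnm_pred r (a : 'X_{1..r}) k : mdeg a = k.+1 ->
  exists j b, a = (U_(j) + b)%MM /\ mdeg b = k.
Proof.
move=> ak; have /existsP[j aj] : [exists j, a j != 0%N].
  apply: contra_eqT ak; rewrite negb_exists => /forallP a0.
  suff -> : a = 0%MM by rewrite mdeg0.
  by apply/mnmP => j; rewrite mnm0E; apply/eqP/negPn/a0.
have E : a = (U_(j) + (a - U_(j)))%MM by rewrite addmC submK // lep1mP.
exists j, (a - U_(j))%MM; split=> //.
by move: ak; rewrite {1}E mdegD mdeg1 add1n => -[].
Qed.

Lemma mmap1D r (A : comNzRingType) (h : 'I_r -> A) a b :
  mmap1 h (a + b)%MM = mmap1 h a * mmap1 h b.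
Proof.
by rewrite /mmap1 -big_split; apply: eq_bigr => j _; rewrite mnmDE exprD.
Qed.

Section Products.
Variables (K : fieldType) (n r d : nat).
Local Notation P := {mpoly K[n]}.
Variable h : 'I_r -> P.
Hypothesis hh : forall j, h j \is d.-homog.

Local Notation "h ^^ a" := (mmap1 h a) (at level 30).

Lemma mmap1_homog a : h ^^ a \is (d * mdeg a).-homog.
Proof.
rewrite /mmap1 mdegE big_distrr /=.
apply: (big_ind2 (fun (p : P) k => p \is k.-homog)).
- exact: dhomog1.
- by move=> p k q l; apply: dhomogM.
- by move=> j _; apply: dhomogMn.
Qed.

(** By [pow_span_homogP] these span the part of degree dk + e of the k-th power of the ideal
    generated by [h]. *)
Definition products k e (x : monomial r k * monomial n e) : P :=
  h ^^ val x.1 * 'X_[val x.2].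

Lemma products_homog k e x : @products k e x \is (d * k + e).-homog.
Proof.
have := mmap1_homog (val x.1); rewrite mdeg_monomial => hx.
by apply: dhomogM => //; rewrite dhomogX; apply/eqP/mdeg_monomial.
Qed.

Lemma in_span_products k e (a : 'X_{1..r}) p :
  mdeg a = k -> p \is e.-homog -> in_span (@products k e) (h ^^ a * p).
Proof.
move=> ak; have [x ->] := monomialP ak; move: p; apply: homog_ind.
- by rewrite mulr0; apply: in_span0.
- by move=> p q; rewrite mulrDr; apply: in_spanD.
- by move=> c p; rewrite -scalerAr; apply: in_spanZ.
- by move=> m /monomialP[y ->]; apply: (in_span_mem (@products k e) (x, y)).
Qed.

Lemma products_mul k e k' e' p q :
    in_span (@products k e) p -> in_span (@products k' e') q ->
  in_span (@products (k + k') (e + e')) (p * q).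
Proof.
move=> [b ->] [c ->]; rewrite big_distrl; apply: in_span_sum => x _.
rewrite big_distrr; apply: in_span_sum => y _ /=.
rewrite -scalerAl -scalerAr; apply/in_spanZ/in_spanZ.
rewrite {2 3}/products mulrACA -mmap1D -mpolyXD.
apply: in_span_products; first by rewrite mdegD !mdeg_monomial.
by rewrite dhomogX /= mdegD !mdeg_monomial.
Qed.

Definition pow_span k p : Prop :=
  exists l : monomial r k -> P, p = \sum_a l a * h ^^ val a.

Lemma pow_span_mem k a q : mdeg a = k -> pow_span k (q * h ^^ a).
Proof.
case/monomialP=> x ->; exists (fun y => if y == x then q else 0).
rewrite (bigD1 x) //= eqxx big1 ?addr0 // => y /negbTE->.
by rewrite mul0r.
Qed.

Lemma pow_span0 k : pow_span k 0.
Proof. by exists (fun=> 0); rewrite big1 // => a _; rewrite mul0r. Qed.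

Lemma pow_span_linear k c p q :
  pow_span k p -> pow_span k q -> pow_span k (c * p + q).
Proof.
move=> [a ->] [b ->]; exists (fun x => c * a x + b x).
rewrite big_distrr -big_split; apply: eq_bigr => x _ /=.
by rewrite mulrDl mulrA.
Qed.

Definition gen_ideal : P -> Prop := ideal_span (fun p => exists j, p = h j).

(** From left to right, [pow_span] is closed under linear combinations, so it suffices to multiply a
    generator by a power product. From right to left, generators are peeled off a power product one
    at a time. *)
Lemma ideal_powP k p : ideal_pow gen_ideal k p <-> pow_span k p.
Proof.
split.
  elim: k p => [p _|k IH].
    by rewrite -[p]mulr1 -(mmap11 h); apply: pow_span_mem; rewrite mdeg0.
  apply: ideal_span_sub; [exact: pow_span0|exact: pow_span_linear|].
  move=> _ [x [y [xI /IH[l ->] ->]]]; move: x xI; apply: ideal_span_sub.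
  - by rewrite mul0r; apply: pow_span0.
  - by move=> a u v pu pv; rewrite mulrDl -mulrA; apply: pow_span_linear.
  move=> _ [j ->]; rewrite big_distrr /=; elim/big_ind: _ => //.
  - exact: pow_span0.
  - by move=> u v pu pv; rewrite -[u]mul1r; apply: pow_span_linear.
  move=> a _; rewrite mulrCA -(mmap1U h) -mmap1D.
  by apply: pow_span_mem; rewrite mdegD mdeg1 mdeg_monomial.
have lin I S : (forall q, I q <-> @ideal_span P S q) ->
    forall T (s : seq T) (F : T -> P), (forall x, I (F x)) -> I (\sum_(x <- s) F x).
  move=> IS T s F IF; apply/IS; elim/big_ind: _ => //.
  - exact: ideal_span0.
  - by move=> u v pu pv; rewrite -[u]mul1r; apply: ideal_span_linear.
  - by move=> x _; apply/IS.
case=> l ->; case: k l => [|k] l; first by [].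
apply: (lin _ _ (fun q => iff_refl _)) => a {lin}; move: (mdeg_monomial a).
move: (l a) (val a) => {l} q {}a.
rewrite -[_ * _]addr0 => ak; apply: ideal_span_linear; last exact: ideal_span0.
(* The induction starts at exponent 1, because the power of exponent 0 is the whole ring and is not
   presented as a span. *)
elim: k a ak => [|k IH] a /mnm_pred[j [b [-> bk]]]; rewrite mmap1D mmap1U.
  exists 1%N, (fun=> 1), (fun=> h j * h ^^ b); split=> [_|]; last first.
    by rewrite big_ord1 mul1r.
  exists (h j), (h ^^ b); split=> //.
  exists 1%N, (fun=> 1), (fun=> h j); split=> [_|]; first by exists j.
  by rewrite big_ord1 mul1r.
exists 1%N, (fun=> 1), (fun=> h j * h ^^ b); split=> [_|]; last first.
  by rewrite big_ord1 mul1r.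
exists (h j), (h ^^ b); split=> //; last exact: IH.
exists 1%N, (fun=> 1), (fun=> h j); split=> [_|]; first by exists j.
by rewrite big_ord1 mul1r.
Qed.

(** This replaces the arbitrary cofactors in an ideal membership by homogeneous ones. The case
    distinction is needed since [i - e] is truncated. *)
Lemma pihomogM_homog e i (p q : P) : q \is e.-homog ->
  pihomog mdeg i (p * q) = if (e <= i)%N then pihomog mdeg (i - e) p * q else 0.
Proof.
move=> hq; rewrite [p]mpolyE big_distrl /= !linear_sum.
rewrite [in RHS]big_distrl /=.
transitivity (\sum_(m <- msupp p)
  (if (e <= i)%N then pihomog mdeg (i - e) (p@_m *: 'X_[m] : P) * q else 0)); last first.
  by case: ifP => // _; rewrite big1.
apply: eq_bigr => m _; rewrite -scalerAl !linearZ /= pihomogX.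
have hm : 'X_[K, m] * q \is (mdeg m + e).-homog.
  by apply: dhomogM => //; rewrite dhomogX.
have [ei|ei] := leqP e i.
  have [E|ne] := eqVneq (mdeg m) (i - e)%N.
    by rewrite pihomog_dE ?scalerAl // -(subnK ei) -E.
  rewrite (pihomog_ne0 _ hm) ?scaler0 ?mul0r //.
  by apply: contra ne => /eqP <-; rewrite addnK.
rewrite (pihomog_ne0 _ hm) ?scaler0 //.
by rewrite neq_ltn orbC (leq_trans ei) ?leq_addl.
Qed.

Lemma pow_span_homog_low k i p :
  (i < d * k)%N -> p \is i.-homog -> pow_span k p -> p = 0.
Proof.
move=> ik hp [l pE]; rewrite -(pihomog_dE hp) pE linear_sum big1 // => a _.
have := mmap1_homog (val a); rewrite mdeg_monomial => ha.
by rewrite /= (pihomogM_homog _ _ ha) leqNgt ik.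
Qed.

Lemma pow_span_homogP k e p : p \is (d * k + e).-homog ->
  pow_span k p <-> in_span (@products k e) p.
Proof.
move=> hp; split=> [[l pE]|[c ->]].
  rewrite -(pihomog_dE hp) pE linear_sum; apply: in_span_sum => a _.
  have := mmap1_homog (val a); rewrite mdeg_monomial => ha.
  rewrite /= (pihomogM_homog _ _ ha) leq_addr addKn mulrC.
  by apply: in_span_products; rewrite ?mdeg_monomial ?pihomogP.
elim/big_ind: _ => //.
- exact: pow_span0.
- by move=> u v pu pv; rewrite -[u]mul1r; apply: pow_span_linear.
move=> x _; rewrite /products -mul_mpolyC -[_ * _]addr0.
apply: pow_span_linear; last exact: pow_span0.
by rewrite mulrC; apply: pow_span_mem; rewrite mdeg_monomial.
Qed.

End Products.

(** * Spanning the forms of a given degree *)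

Section Surjectivity.
Variables (K : fieldType) (n r d : nat).
Local Notation P := {mpoly K[n]}.
Variable h : 'I_r -> P.

(** For forms of degree d: the k-th power of their ideal contains every form of degree dk + e. *)
Definition spanning k e : Prop :=
  forall p, p \is (d * k + e).-homog -> in_span (products h (k := k) (e := e)) p.

Lemma spanning_monomial k e :
    (forall m : 'X_{1..n}, mdeg m = (d * k + e)%N ->
       in_span (products h (k := k) (e := e)) 'X_[m]) ->
  spanning k e.
Proof.
move=> sm; apply: homog_ind => // [|p q|c p].
- exact: in_span0.
- exact: in_spanD.
- exact: in_spanZ.
Qed.

Lemma spanning0 e : spanning 0 e.
Proof.
move=> p; rewrite muln0 => hp; rewrite -[p]mul1r -(mmap11 h).
by apply: in_span_products => //; apply: mdeg0.
Qed.

Lemma spanning1_ge e0 e : (e0 <= e)%N -> spanning 1 e0 -> spanning 1 e.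
Proof.
move/subnKC <-; move: (e - e0)%N => j {e} s0; elim: j => [|j IH].
  by rewrite addn0.
apply: spanning_monomial => m; rewrite !addnS => /mnm_pred[i [b [-> bm]]].
have hX : 'X_[K, b] \is (d * 1 + (e0 + j)).-homog by rewrite dhomogX -bm.
have hi : in_span (products h (k := 0) (e := 1)) 'X_i.
  by apply: spanning0; rewrite muln0 dhomogX /= mdeg1.
have := products_mul hi (IH _ hX).
by rewrite mpolyXD add0n add1n.
Qed.

(** Since d(k+1) + e = d + (dk + e), a form can first be written with one generator in front; its
    cofactors have degree dk + e and are expanded by the hypothesis on [k]. *)
Lemma spanning_succ k e :
  spanning k e -> spanning 1 (d * k + e) -> spanning k.+1 e.
Proof.
move=> sk s1 p; rewrite mulnS -addnA -[X in (X + _)%N]muln1 => /s1 [c ->].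
apply: in_span_sum => -[a m] _; apply: in_spanZ; rewrite {2}/products /=.
have ha : in_span (products h (k := 1) (e := 0)) (mmap1 h (val a)).
  rewrite -[mmap1 _ _]mulr1; apply: in_span_products; last exact: dhomog1.
  exact: mdeg_monomial.
have hm : in_span (products h (k := k) (e := e)) 'X_[val m].
  by apply: sk; rewrite dhomogX; apply/eqP/mdeg_monomial.
by have := products_mul ha hm; rewrite add0n add1n.
Qed.

Lemma spanning_ge k e e0 : (0 < d)%N -> (e0 <= e)%N ->
  spanning 1 e0 -> spanning k e.
Proof.
move=> d0 e0e s; elim: k => [|k IH]; first exact: spanning0.
by apply: spanning_succ => //; apply: spanning1_ge s; lia.
Qed.

Lemma spanning_ge2 k0 k e e0 : (0 < d)%N -> (k0 <= k)%N -> (e0 <= d * k0 + e)%N ->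
  spanning 1 e0 -> spanning k0 e -> spanning k e.
Proof.
move=> d0 /subnKC <- e0e s s0; elim: (k - k0)%N => [|j IH]; first by rewrite addn0.
by rewrite addnS; apply: spanning_succ => //; apply: spanning1_ge s; nia.
Qed.

End Surjectivity.

(** * Openness of rank conditions on tuples of forms *)

Section GenericForms.
Variables (K : numFieldType) (V : vectType K) (n : nat).
Local Notation P := {mpoly K[n]}.

Definition polyfun_coefs (p : V -> P) : Prop := forall m, polyfun (fun v => (p v)@_m).

Lemma polyfun_coefs_const p : polyfun_coefs (fun=> p).
Proof. by move=> m; apply: polyfun_const. Qed.

Lemma polyfun_coefsM p q :
  polyfun_coefs p -> polyfun_coefs q -> polyfun_coefs (fun v => p v * q v).
Proof.
move=> hp hq m.
pose F v := \sum_(x : 'X_{1..n < (mdeg m).+1, (mdeg m).+1} | m == (x.1 + x.2)%MM)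
  (p v)@_x.1 * (q v)@_x.2.
apply: (@eq_polyfun _ _ _ F) => [v|]; first exact: mcoeff_poly_mul.
by apply: polyfun_sum => x; apply: polyfunM.
Qed.

Lemma polyfun_coefs_prod I (s : seq I) (F : I -> V -> P) :
    (forall i, polyfun_coefs (F i)) ->
  polyfun_coefs (fun v => \prod_(i <- s) F i v).
Proof.
move=> hF; elim: s => [|i s IH] m.
  by apply: eq_polyfun (polyfun_coefs_const 1 m) => v; rewrite big_nil.
by apply: eq_polyfun (polyfun_coefsM (hF i) IH m) => v; rewrite big_cons.
Qed.

Lemma polyfun_coefsX p k : polyfun_coefs p -> polyfun_coefs (fun v => p v ^+ k).
Proof.
move=> hp; elim: k => [|k IH] m.
  by apply: eq_polyfun (polyfun_coefs_const 1 m) => v; rewrite expr0.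
by apply: eq_polyfun (polyfun_coefsM hp IH m) => v; rewrite exprS.
Qed.

Lemma generic_family_rank d (I : finType) (u : V -> I -> P) (v0 : V) :
    (forall i, polyfun_coefs (u^~ i)) ->
  generic (fun v => (family_rank d (u v0) <= family_rank d (u v))%N).
Proof.
move=> pu; apply: generic_rank => i j.
by apply: eq_polyfun (pu (enum_val i) (val (enum_val j))) => v; rewrite mxE.
Qed.

End GenericForms.

Section Forms.
Variables (K : numFieldType) (n r d : nat).
Local Notation P := {mpoly K[n.+1]}.
Local Notation F := {ffun 'I_r -> dhomog n.+1 K d}.

Definition form_at (f : F) (j : 'I_r) : P := f j.

Lemma form_homog f j : form_at f j \is d.-homog.
Proof. exact: dhomog_is_dhomog. Qed.

Lemma form_ex (p : 'I_r -> P) : (forall j, p j \is d.-homog) ->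
  exists f, form_at f =1 p.
Proof.
move=> hp; exists [ffun j => DHomog (hp j)] => j.
by rewrite /form_at ffunE.
Qed.

Lemma polyfun_form j : polyfun_coefs (fun f : F => form_at f j).
Proof.
move=> m; pose c (f : F) := (form_at f j)@_m.
have lc : scalar c.
  by move=> a f g; rewrite /c /form_at !ffunE /= mcoeffD mcoeffZ.
pose C : {scalar F} := HB.pack c (GRing.isLinear.Build _ _ _ _ c lc).
exact: (polyfun_scalar C).
Qed.

Lemma polyfun_mmap1 (a : 'X_{1..r}) : polyfun_coefs (fun f : F => mmap1 (form_at f) a).
Proof. by apply: polyfun_coefs_prod => j; apply/polyfun_coefsX/polyfun_form. Qed.

Lemma polyfun_products k e x :
  polyfun_coefs (fun f : F => products (form_at f) (k := k) (e := e) x).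
Proof.
by apply: polyfun_coefsM (polyfun_mmap1 _) _; apply: polyfun_coefs_const.
Qed.

(** Spanning says that a rank takes its largest possible value, so one example forces it on a
    nonempty open set. *)
Lemma generic_spanning k e (h : 'I_r -> P) :
    (forall j, h j \is d.-homog) -> spanning d h k e ->
  generic (fun f : F => spanning d (form_at f) k e).
Proof.
move=> /form_ex[f0 f0h] sh.
have s0 : spanning d (form_at f0) k e.
  move=> p /sh[c ->]; exists c; apply: eq_bigr => x _.
  by rewrite /products (mmap1_eq _ f0h).
move: (generic_family_rank (d * k + e) f0 (polyfun_products (k := k) (e := e))).
apply: generic_imply => f.
have /(span_allP (@products_homog _ _ _ _ _ (form_homog f0) k e))-> := s0.
move=> le; apply/(span_allP (@products_homog _ _ _ _ _ (form_homog f) k e)).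
by apply/eqP; rewrite eqn_leq family_rank_le_monomial.
Qed.

End Forms.

(** * Three cubes and a fourth cubic *)

Definition trinom (s : nat * nat * nat) : 'X_{1..3} :=
  [multinom tnth [tuple s.1.1; s.1.2; s.2] i | i < 3].

Lemma trinomE (m : 'X_{1..3}) :
  m = trinom (m ord0, m (lift ord0 ord0), m ord_max).
Proof.
apply/mnmP=> -[[|[|[|//]]] i]; rewrite mnmE /= (tnth_nth 0%N) /=;
  by congr (m _); apply: val_inj.
Qed.

Lemma mdeg_trinom a b c : mdeg (trinom (a, b, c)) = (a + b + c)%N.
Proof. by rewrite mdegE !big_ord_recl big_ord0 !mnmE !(tnth_nth 0%N) /= addn0 addnA. Qed.

Lemma trinomD s t : (trinom s + trinom t)%MM =
  trinom ((s.1.1 + t.1.1)%N, (s.1.2 + t.1.2)%N, (s.2 + t.2)%N).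
Proof.
by apply/mnmP=> -[[|[|[|//]]] i]; rewrite mnmDE !mnmE !(tnth_nth 0%N).
Qed.

Section CubicForms.
Variable K : fieldType.
Local Notation P := {mpoly K[3]}.
Variable g : P.

(** The form [g] sits at [ord_max], the position whose exponent is bounded in [low_monomial]. *)
Definition cubic_forms (j : 'I_4) : P :=
  if unlift ord_max j is Some i then 'X_i ^+ 3 else g.

Lemma cubic_forms_homog : g \is 3.-homog -> forall j, cubic_forms j \is 3.-homog.
Proof.
move=> hg j; rewrite /cubic_forms; case: unliftP => [i _|//] /=.
by rewrite mpolyXn dhomogX /= mdegMn mdeg1.
Qed.

Lemma cubic_forms_mmap1 (a b c e : nat) (al : 'X_{1..4}) :
    al = [multinom tnth [tuple a; b; c; e] i | i < 4] ->
  mmap1 cubic_forms al = 'X_[trinom (3 * a, 3 * b, 3 * c)%N] * g ^+ e.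
Proof.
move=> ->; rewrite /mmap1 big_ord_recr /= /cubic_forms unlift_none mnmE.
rewrite (tnth_nth 0%N) /=; congr (_ * _).
rewrite [RHS]mpolyXE_id; apply: eq_bigr => i _.
have -> : widen_ord (leqnSn 3) i = lift ord_max i by apply/val_inj/esym/lift_max.
rewrite liftK !mnmE -exprM !(tnth_nth 0%N) lift_max /=; congr (_ ^+ _).
by case: i => -[|[|[|//]]].
Qed.

Lemma cubic_span (a b c e l : nat) (s : nat * nat * nat) :
  (l = s.1.1 + s.1.2 + s.2)%N ->
  in_span (products cubic_forms (k := a + b + c + e) (e := l))
    ('X_[trinom (3 * a + s.1.1, 3 * b + s.1.2, 3 * c + s.2)%N] * g ^+ e).
Proof.
case: s => -[s0 s1] s2 /= ->; rewrite -(trinomD (_, _, _) (s0, s1, s2)) mpolyXD.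
rewrite -mulrA [X in _ * X]mulrC mulrA -(cubic_forms_mmap1 erefl).
apply: in_span_products; last by rewrite dhomogX /= mdeg_trinom.
by rewrite mdegE !big_ord_recl big_ord0 !mnmE !(tnth_nth 0%N) /= addn0 !addnA.
Qed.

Lemma cubic_span_cube e (m : 'X_{1..3}) i :
    (2 < m i)%N -> mdeg m = (3 + e)%N ->
  in_span (products cubic_forms (k := 1) (e := e)) 'X_[m].
Proof.
rewrite [m]trinomE mdeg_trinom mnmE (tnth_nth 0%N).
move: (m _) (m _) (m _) => c b a; case: i => -[|[|[|//]]] i /= a3 E.
- have := @cubic_span 1 0 0 0 e ((a - 3)%N, b, c).
  by rewrite /= !muln0 muln1 !add0n mulr1 subnKC //; apply; lia.
- have := @cubic_span 0 1 0 0 e (a, (b - 3)%N, c).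
  by rewrite /= !muln0 muln1 !add0n mulr1 subnKC //; apply; lia.
- have := @cubic_span 0 0 1 0 e (a, b, (c - 3)%N).
  by rewrite /= !muln0 muln1 !add0n mulr1 subnKC //; apply; lia.
Qed.

End CubicForms.

(** A monomial of degree 5 with all exponents at most 2 has all exponents at least 1, so it is
    divisible by xyz; any other one is divisible by a cube. *)
Lemma spanning_1_2 (K : fieldType) :
  spanning 3 (cubic_forms ('X_[trinom (1, 1, 1)%N] : {mpoly K[3]})) 1 2.
Proof.
apply: spanning_monomial => m; rewrite [m]trinomE mdeg_trinom.
move: (m _) (m _) (m _) => c b a E.
have [a3|a3] := ltnP 2 a.
  by apply: (cubic_span_cube _ (i := ord0)); rewrite ?mdeg_trinom ?mnmE.
have [b3|b3] := ltnP 2 b.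
  by apply: (cubic_span_cube _ (i := lift ord0 ord0)); rewrite ?mdeg_trinom ?mnmE.
have [c3|c3] := ltnP 2 c.
  by apply: (cubic_span_cube _ (i := ord_max)); rewrite ?mdeg_trinom ?mnmE.
have := @cubic_span K 'X_[trinom (1, 1, 1)%N] 0 0 0 1 2 (a.-1, b.-1, c.-1).
rewrite expr1 -mpolyXD trinomD /= !muln0 !add0n !addn1.
by rewrite !prednK; [apply| | |]; lia.
Qed.

(** * Computation with ternary polynomials as lists of terms, and the matrix in degree 13 *)

Definition term : Type := (nat * (nat * nat * nat))%type.

Definition term_mul (x y : term) : term :=
  (x.1 * y.1, (x.2.1.1 + y.2.1.1, x.2.1.2 + y.2.1.2, x.2.2 + y.2.2))%N.

Fixpoint add_term (x : term) (p : seq term) : seq term :=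
  if p is y :: p' then
    if x.2 == y.2 then ((x.1 + y.1)%N, x.2) :: p' else y :: add_term x p'
  else [:: x].

Definition terms_mul (p q : seq term) : seq term :=
  foldr add_term [::] [seq term_mul x y | x <- p, y <- q].

Section Terms.
Variable K : fieldType.
Local Notation P := {mpoly K[3]}.

Definition term_poly (x : term) : P := x.1%:R *: 'X_[trinom x.2].
Definition terms_poly (p : seq term) : P := \sum_(x <- p) term_poly x.

Lemma terms_poly_add x p : terms_poly (add_term x p) = term_poly x + terms_poly p.
Proof.
rewrite /terms_poly; elim: p => [|y p IH] /=; first by rewrite big_seq1 big_nil addr0.
rewrite big_cons; case: eqP => [E|_]; rewrite big_cons.
  by rewrite addrA /term_poly /= natrD scalerDl E.
by rewrite IH addrCA.
Qed.

Lemma terms_poly_mul p q : terms_poly (terms_mul p q) = terms_poly p * terms_poly q.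
Proof.
rewrite /terms_mul; transitivity (terms_poly [seq term_mul x y | x <- p, y <- q]).
  elim: [seq _ | x <- p, y <- q] => [|x l IH] //=.
  by rewrite terms_poly_add IH /terms_poly big_cons.
rewrite /terms_poly big_flatten big_map big_distrl; apply: eq_bigr => x _.
rewrite big_map big_distrr; apply: eq_bigr => y _ /=; rewrite /term_poly /=.
by rewrite -scalerAl -scalerAr scalerA natrM -mpolyXD trinomD.
Qed.

Lemma terms_poly1 : terms_poly [:: (1, (0, 0, 0))%N] = 1.
Proof.
rewrite /terms_poly big_seq1 /term_poly /= scale1r -mpolyX0; congr 'X_[_].
by apply/eqP; rewrite -mdeg_eq0 mdeg_trinom.
Qed.

End Terms.

Definition triples (d : nat) : seq (nat * nat * nat) :=
  flatten [seq [seq (a, b, d - a - b)%N | b <- iota 0 (d.+1 - a)] | a <- iota 0 d.+1].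

(* Such a monomial is a linear form times a monomial in the cubes. *)
Definition linear_residue (s : nat * nat * nat) : bool :=
  (s.1.1 %% 3 + s.1.2 %% 3 + s.2 %% 3 == 1)%N.

(* A cubic form g, found by search, for which the products of degree 13 of the
   linear forms and of x^3, y^3, z^3, g are independent. *)
Definition quintinomial : seq term :=
  [:: (1, (2, 1, 0)); (1, (2, 0, 1)); (1, (1, 2, 0)); (1, (0, 2, 1)); (1, (1, 0, 2))]%N.

Definition quintinomial_pow (j : nat) : seq term :=
  iter j (terms_mul quintinomial) [:: (1, (0, 0, 0))%N].

(** Of the 105 monomials of degree 13, the 3 * 15 = 45 with [linear_residue] are variables times
    four cubes, hence already products; 60 remain. *)
Definition targets : seq (nat * nat * nat) :=
  [seq s <- triples 13 | ~~ linear_residue s].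

(** The pair (j, s) stands for the product of the monomial s and g^j. With j from 1 to 4 there are 3
    * (10 + 6 + 3 + 1) = 60 of them, so that the matrix is square. *)
Definition sources : seq (nat * (nat * nat * nat)) :=
  flatten [seq [seq (j, s) | s <- triples (13 - 3 * j) & linear_residue s]
          | j <- iota 1 4].

Definition source_terms (x : nat * (nat * nat * nat)) : seq term :=
  [seq term_mul (1%N, x.2) y | y <- quintinomial_pow x.1].

Definition coefficient (p : seq term) (s : nat * nat * nat) : nat :=
  sumn [seq x.1 | x <- p & x.2 == s].

(** The sources modulo the span of the [linear_residue] monomials. *)
Definition source_matrix : seq (seq nat) :=
  [seq let p := source_terms x in [seq coefficient p s | s <- targets] | x <- sources].

(* The low bits of the ASCII code of a digit are those of the digit. *)
Fixpoint digits (s : string) : seq nat :=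
  if s is String (Ascii a b c _ _ _ _ _) s' then
    (a + 2 * b + 4 * c)%N :: digits s'
  else [::].

(* The columns of the inverse of [source_matrix] modulo 5, found by computer. *)
Definition inverse_columns : seq (seq nat) := map digits [::
   "100000000000000000000000000000000000000000000000000000000000";
   "000010000000000000000000000000000000000000000000000000000000";
   "110010000000040000000000000000000000000000000000000000000000";
   "433323332030121403203020431441222110231112302240003233004100";
   "332042120224142231023244114010120123123421344224142021403032";
   "141000400300223010101000140002112223321122304021342044001400";
   "413032220321043112314321314012413014412304122340012124012122";
   "000100000004000000000001000000000000000000000000000000000000";
   "400004000000200000000000000000000000000000000000000000000000";
   "230121443040430210411401143334400334110114442242221310034011";
   "403131230021143344432212412114442004001424233433402220212013";
   "413332220322043112314321314012413014412304122340012124012122";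
   "023444000414333441214204401441030442322134302011203222040233";
   "332441232033242403030443331133442314120201121100440441002300";
   "440012243113404021311022100033444423343333342202003132340342";
   "441444310231110143023143424431233210241443233230102020332320";
   "241321134242430304201142321002020114030144244444224110024244";
   "232223230144230403341224332040203214414324232231330420044333";
   "004324110331244222032420311211124421440412103301334400113240";
   "300140211400342044422223342342342120444424030000000114433443";
   "431104112340432331012401122104401040224114342103103032044333";
   "340431211214420321122204430200414421214422143441011410043433";
   "312233003334220223002402222231411230313113431343032042443210";
   "320434422232120424444043200333401002011400402234221343414204";
   "222303013414141341402031443301241243404242104113301200140401";
   "241404431334041210240343304121011231322004411034422234140401";
   "344310432013431210421131443143420204343203022442244242204041";
   "201322002413330000412131233044323041042403222321230430232434";
   "201322002413330000412131233044323041042403222321230430232330";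
   "000000000000000000000000000000000000000000000000000000000323";
   "000001000000400000000000000000000000000000000000000000000000";
   "400040000000010000000000000000000000000000000000000000000000";
   "300032010000320400000000000000000000000000000000000000000000";
   "402340233223010344102403100203113312311022323411120113210213";
   "400313424224304033033303342033401314343341144404001432113240";
   "142123330234012443241234241043142041143201433210043431043433";
   "033312232030122403203020431441222110231112302240003233004100";
   "003034032301011200403400040120213122132022401224404244020144";
   "313140144030342140342134101040314323200140211244013001120312";
   "422220133143421413202324042141311422304113114324101412411004";
   "221403442024141224312021024002021000030321142234112343014422";
   "043131324132311043242434411322204043112323330112014231310431";
   "242422002212330332330404234211334430131343423333443002121212";
   "333241134040242131342124032223411444120113111204340323103423";
   "134201130213123131132413234330324002314021202120430144041133";
   "242042410332424410141211400221103221222200140022223221322003";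
   "242042410332424410141211400221103221222200140022223221313131";
   "304233003142220000143424322011232014013102333234320120323403";
   "233341232030024403203020431441222110231112302240003233004100";
   "120310204020040030233203324442200442330332221121113430042033";
   "323114441302031224131023140021231023404311021233122002030411";
   "334433241231220303404143140003333223443111222021030430423121";
   "420300222423332330244403104411412301422404430133232220300114";
   "124044230404001230432100234400013124114304242231330143244224";
   "401411010422004400323221132313411034120113002343344433104323";
   "112321424420212201224203042430331433032202320402214241244224";
   "210102144044241140233001011312043311312101304120242144130134";
   "322223202113403030430413341342322120121112443420343421442310";
   "413200221012332112431013312301013020040413321142331424032211";
   "101210130101040022123341221312403202130423041240122010032211"
  ]%string.

Definition dot (u v : seq nat) : nat := sumn [seq x.1 * x.2 | x <- zip u v]%N.

Definition certificate : bool :=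
  [&& size targets == 60, size sources == 60, uniq targets,
      all (fun x => all (fun t => linear_residue t.2 || (t.2 \in targets)) (source_terms x))
        sources,
      all (fun x => all (fun t => t.2.1.1 + t.2.1.2 + t.2.2 == 13) (source_terms x)) sources &
      all (fun i => all (fun k =>
          dot (nth [::] source_matrix i) (nth [::] inverse_columns k) %% 5 == (i == k))
        (iota 0 60)) (iota 0 60)]%N.

Lemma certificateP : certificate.
Proof. by vm_compute. Qed.

Lemma mem_triples d s : (s \in triples d) = (s.1.1 + s.1.2 + s.2 == d)%N.
Proof.
case: s => -[a b] c /=; apply/flatten_mapP/idP => [[a' _ /mapP[b' + [-> -> ->]]]|/eqP <-].
  by rewrite mem_iota => ?; lia.
exists a; first by rewrite mem_iota; lia.
apply/mapP; exists b; first by rewrite mem_iota; lia.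
by congr (_, _, _); lia.
Qed.

Lemma dotE u v : dot u v = (\sum_(l < size u) nth 0 u l * nth 0 v l)%N.
Proof.
elim: u v => [|x u IH] [|y v]; rewrite /dot /= ?big_ord0 //.
  by rewrite big1 // => l _; rewrite nth_nil muln0.
by rewrite big_ord_recl; congr addn; apply: IH.
Qed.

Section Quintinomial.
Variable K : numFieldType.
Local Notation P := {mpoly K[3]}.
Let g : P := terms_poly K quintinomial.
Local Notation S := (in_span (products (cubic_forms g) (k := 4) (e := 1))).

Lemma quintinomial_homog : g \is 3.-homog.
Proof.
rewrite /g /terms_poly big_seq; apply: rpred_sum => -[c [[a b] e]] t3.
apply: rpredZ; rewrite dhomogX /= mdeg_trinom.
have : all (fun t : term => t.2.1.1 + t.2.1.2 + t.2.2 == 3)%N quintinomial by [].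
by move/allP/(_ _ t3).
Qed.

Lemma quintinomial_powE j : terms_poly K (quintinomial_pow j) = g ^+ j.
Proof.
elim: j => [|j IH]; first exact: terms_poly1.
by rewrite /quintinomial_pow iterS terms_poly_mul exprS -IH.
Qed.

(** Dividing the exponents by 3 leaves a remainder of degree 1, so the quotients add up to 4 - j and
    there are four factors in all. *)
Lemma linear_residue_span j s :
    linear_residue s -> (s.1.1 + s.1.2 + s.2 + 3 * j = 13)%N ->
  S ('X_[trinom s] * g ^+ j).
Proof.
case: s => -[a b] c; rewrite /linear_residue /= => /eqP res E.
have := @cubic_span K g (a %/ 3) (b %/ 3) (c %/ 3) j 1 (a %% 3, b %% 3, c %% 3)%N.
rewrite /= (_ : a %/ 3 + b %/ 3 + c %/ 3 + j = 4)%N; last by lia.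
by rewrite !(mulnC 3) -!divn_eq; apply; rewrite res.
Qed.

Lemma source_termsE x :
  terms_poly K (source_terms x) = 'X_[trinom x.2] * g ^+ x.1.
Proof.
rewrite -quintinomial_powE /source_terms /terms_poly big_map big_distrr.
apply: eq_bigr => y _; rewrite /term_poly /= mul1n -scalerAr -mpolyXD trinomD.
by [].
Qed.

Lemma terms_poly_targets (tg : seq (nat * nat * nat)) p :
    uniq tg -> {in tg, forall s, ~~ linear_residue s} ->
    all (fun t : term => linear_residue t.2 || (t.2 \in tg)) p ->
  terms_poly K p = \sum_(s <- tg) (coefficient p s)%:R *: 'X_[trinom s]
    + \sum_(t <- p | linear_residue t.2) term_poly K t.
Proof.
move=> ut nl; rewrite /terms_poly; elim: p => [_|t p IH /= /andP[tt /IH E]].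
  by rewrite !big_nil big1 ?addr0 // => s _; rewrite scale0r.
rewrite !big_cons {}E.
have cE s : coefficient (t :: p) s = ((t.2 == s) * t.1 + coefficient p s)%N.
  by rewrite /coefficient /=; case: eqP => _; rewrite /= ?mul1n.
under [in RHS]eq_bigr => s _ do rewrite cE natrD scalerDl.
rewrite big_split /=; case lt: (linear_residue t.2) tt => /= tt.
  rewrite [X in _ = X + _ + _]big_seq [X in _ = X + _ + _]big1 ?add0r 1?addrCA //.
  move=> s /nl ns.
  have /negbTE-> : t.2 != s by apply: contraNneq ns => <-.
  by rewrite scale0r.
rewrite [X in _ = X + _ + _](bigD1_seq t.2) //= ?eqxx ?mul1n.
rewrite [X in _ = _ + X + _ + _]big1 ?addr0 ?addrA //.
by move=> s; rewrite eq_sym => /negbTE->; rewrite scale0r.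
Qed.

(** Each source is a combination of targets plus [linear_residue] monomials. The latter lie in the
    span, hence so does the combination of targets, and inverting the matrix of these combinations
    yields every target. *)
Lemma spanning_4_1 : spanning 3 (cubic_forms g) 4 1.
Proof.
have /and5P[/eqP st /eqP ss ut /allP src /andP[/allP deg /allP inv]] := certificateP.
pose x0 : nat * (nat * nat * nat) := (0, (0, 0, 0))%N.
pose y0 : nat * nat * nat := (0, 0, 0)%N.
pose Z : 'M[int]_60 := \matrix_(i, l) (nth 0%N (nth [::] source_matrix i) l)%:R.
pose N : 'M[K]_60 := map_mx intr Z.
have NE i l : N i l = (coefficient (source_terms (nth x0 sources i)) (nth y0 targets l))%:R.
  rewrite !mxE /source_matrix (nth_map x0) ?ss // (nth_map y0) ?st //.
  by rewrite rmorph_nat.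
have unitN : N \in unitmx.
  rewrite unitmxE unitfE det_map_mx intr_eq0; apply/eqP => Z0.
  (* The integral determinant is nonzero since it is nonzero modulo 5. *)
  pose B : 'M['F_5]_60 := \matrix_(l, k) (nth 0%N (nth [::] inverse_columns k) l)%:R.
  have : map_mx intr Z *m B = 1%:M.
    apply/matrixP => i k; rewrite !mxE.
    have row60 : size (nth [::] source_matrix i) = 60%N.
      by rewrite /source_matrix (nth_map x0) ?ss // size_map.
    have /inv/allP/(_ (k : nat)) : (i : nat) \in iota 0 60 by rewrite mem_iota /= add0n.
    rewrite mem_iota /= add0n ltn_ord => /(_ isT)/eqP.
    rewrite dotE row60 => E; rewrite -[LHS]natr_Zp.
    transitivity ((\sum_(l < 60) nth 0 (nth [::] source_matrix i) l
                      * nth 0 (nth [::] inverse_columns k) l)%:R : 'F_5).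
      rewrite natr_Zp natr_sum; apply: eq_bigr => l _.
      by rewrite !mxE rmorph_nat natrM.
    by rewrite -(@Fp_nat_mod 5) // E.
  move/mulmx1_unit => -[]; rewrite unitmxE det_map_mx Z0 /=.
  by rewrite unitfE rmorph0 eqxx.
have srcS (i : 'I_60) :
    S (\sum_l N i l *: 'X_[trinom (nth y0 targets l)]).
  set x := nth x0 sources i.
  have xs : x \in sources by rewrite mem_nth // ss.
  have [lx dx] : linear_residue x.2 /\ (x.2.1.1 + x.2.1.2 + x.2.2 + 3 * x.1 = 13)%N.
    case/flatten_mapP: xs => j; rewrite mem_iota => j4 /mapP[s + ->] /=.
    by rewrite mem_filter mem_triples => /andP[-> /eqP->]; split=> //; lia.
  have tg : {in targets, forall s, ~~ linear_residue s}.
    by move=> s; rewrite mem_filter => /andP[].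
  have := terms_poly_targets ut tg (src _ xs); rewrite source_termsE.
  rewrite (big_nth y0) big_mkord st => /eqP; rewrite -subr_eq => /eqP E.
  have -> : \sum_l N i l *: 'X_[trinom (nth y0 targets l)] =
      'X_[trinom x.2] * g ^+ x.1 -
      \sum_(t <- source_terms x | linear_residue t.2) term_poly K t.
    by rewrite E; apply: eq_bigr => l _; rewrite NE.
  apply: in_spanD; first exact: linear_residue_span.
  rewrite -scaleN1r; apply: in_spanZ; rewrite big_seq_cond.
  apply: in_span_sum => t /andP[tx lt]; apply: in_spanZ.
  rewrite -['X_[_]]mulr1 -(expr0 g); apply: linear_residue_span => //.
  by have /allP/(_ _ tx)/eqP-> := deg _ xs.
apply: spanning_monomial => m md.
have [lm|nlm] := boolP (linear_residue (m ord0, m (lift ord0 ord0), m ord_max)).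
  rewrite [m]trinomE -['X_[_]]mulr1 -(expr0 g); apply: linear_residue_span => //.
  by move: md; rewrite {1}[m]trinomE mdeg_trinom /= => ->.
have mt : (m ord0, m (lift ord0 ord0), m ord_max) \in targets.
  by rewrite mem_filter nlm mem_triples -mdeg_trinom -trinomE md.
rewrite [m]trinomE -(nth_index y0 mt).
have kt : (index (m ord0, m (lift ord0 ord0), m ord_max) targets < 60)%N.
  by rewrite -st index_mem.
move: (index _ _) kt => k k60; pose ko := Ordinal k60.
suff -> : 'X_[trinom (nth y0 targets k)] = \sum_i invmx N ko i *:
    \sum_l N i l *: 'X_[K, trinom (nth y0 targets l)].
  by apply: in_span_sum => i _; apply/in_spanZ/srcS.
under eq_bigr => i _ do rewrite scaler_sumr.
have E l : \sum_i invmx N ko i * N i l = (ko == l)%:R.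
  have : (invmx N *m N) ko l = (ko == l)%:R by rewrite mulVmx // mxE.
  by rewrite mxE.
have comb l : \sum_i invmx N ko i *: (N i l *: 'X_[K, trinom (nth y0 targets l)]) =
    (ko == l)%:R *: 'X_[trinom (nth y0 targets l)].
  by rewrite -E scaler_suml; apply: eq_bigr => i _; rewrite scalerA.
rewrite exchange_big /= (bigD1 ko) //= comb eqxx scale1r big1 ?addr0 // => l lk.
by rewrite comb eq_sym (negbTE lk) scale0r.
Qed.

End Quintinomial.

(** * Linear independence of products *)

Lemma free_family_inj (K : fieldType) (V : lmodType K) (I J : finType)
    (w : J -> V) (phi : I -> J) :
  injective phi -> free_family w -> free_family (fun i => w (phi i)).
Proof.
move=> phi_inj wf c c0 i; pose b j := \sum_(i | phi i == j) c i.
have /wf/(_ (phi i)) : \sum_j b j *: w j = 0.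
  rewrite -[RHS]c0 [RHS](partition_big phi predT) //=; apply: eq_bigr => j _.
  by rewrite scaler_suml; apply: eq_bigr => k /eqP->.
rewrite /b (big_pred1 i) // => k.
by rewrite (inj_eq phi_inj).
Qed.

(** Multiplication by [h j] sends distinct products to distinct products of the next exponent, so a
    relation becomes a relation there. *)
Lemma free_products_pred (K : fieldType) n r (h : 'I_r -> {mpoly K[n]}) (j : 'I_r) k e :
    free_family (products h (k := k.+1) (e := e)) ->
  free_family (products h (k := k) (e := e)).
Proof.
move=> hf.
have sh (a : monomial r k) :
    (U_(j) + val a)%MM \in [seq s2m (val t) | t <- enum (basis r k.+1)].
  by rewrite -basis_cover mdegD mdeg1 mdeg_monomial.
pose phi (x : monomial r k * monomial n e) : monomial r k.+1 * monomial n e :=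
  (SeqSub (sh x.1), x.2).
have phi_inj : injective phi.
  move=> [a m] [b l] E; congr (_, _); last exact: (congr1 snd E).
  by apply/val_inj/(@addmI _ U_(j)%MM)/(congr1 (fun x => val x.1) E).
move=> c c0; apply: (free_family_inj phi_inj hf).
rewrite -[RHS](mulr0 (h j)) -[X in _ * X]c0 big_distrr; apply: eq_bigr => x _.
by rewrite /products /= mmap1D mmap1U -scalerAr mulrA.
Qed.

Lemma free_products_linear (K : fieldType) (h : 'I_4 -> {mpoly K[3]}) k :
    (forall j, h j \is 3.-homog) -> spanning 3 h 4 1 -> (k <= 4)%N ->
  free_family (products h (k := k) (e := 1)).
Proof.
move=> hh s4 k4; rewrite -(subKn k4); elim: (4 - k)%N => [|j IH].
  apply/(free_familyP (@products_homog _ _ _ _ _ hh 4 1)).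
  move/(span_allP (@products_homog _ _ _ _ _ hh 4 1)): s4 => ->.
  by rewrite card_prod !card_monomial.
(* Once j reaches 4, both truncated differences are 0 and there is no descent left to make. *)
have [j4|j4] := leqP 4 j.
  suff -> : (4 - j.+1 = 4 - j)%N by [].
  by apply/eqP; rewrite (eqP j4) (eqP (leqW j4)).
by apply: (free_products_pred ord0); rewrite -subSn // subSS.
Qed.

(** * Independence in degree 3k by means of conjugates under cube roots of unity *)

Section Conjugates.
Variable K : numClosedFieldType.
Local Notation P := {mpoly K[3]}.

Lemma primitive_cube_root : exists z : K, 3.-primitive_root z.
Proof.
(* This [z] is a root of X^2 + X + 1; its order divides 3 and is not 1, because 1 + 1 + 1 is
   nonzero. *)
have [z z2] := @solve_monicpoly K 2 (fun=> -1) isT.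
rewrite !big_ord_recl big_ord0 /= expr0 expr1 addr0 mulr1 mulN1r in z2.
have z3 : z ^+ 3 = 1.
  by rewrite exprS z2 mulrDr mulrN1 mulrN -expr2 z2 opprD !opprK addrCA addNr addr0.
have [m pm m3] := prim_order_exists (isT : (0 < 3)%N) z3.
suff -> : 3%N = m by exists z.
apply/esym/(elimT (prime_nt_dvdP _ _) m3) => //.
apply: contraTneq isT => m1; move: pm z2.
rewrite m1 => /prim_expr_order; rewrite expr1 => ->; rewrite expr1n => /eqP.
by rewrite -subr_eq0 opprD !opprK -(natrD _ 1 1) -(natrD _ 1 2) pnatr_eq0.
Qed.

Definition twist (w : 'I_3 -> K) (p : P) : P := p \mPo [tuple w i *: 'X_i | i < 3].

Lemma twistX w m : twist w 'X_[m] = (\prod_i w i ^+ m i) *: 'X_[m].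
Proof.
rewrite /twist comp_mpolyX [in RHS]mpolyXE_id -scaler_prod.
by apply: eq_bigr => i _; rewrite tnth_mktuple exprZn.
Qed.

(** The family a xy^2 + b yz^2 contains xy^2 + yz^2 together with all its images under scaling of
    the variables. *)
Definition conjugate_form (a b : K) : P :=
  a *: 'X_[trinom (1, 2, 0)%N] + b *: 'X_[trinom (0, 1, 2)%N].

Lemma conjugate_form_inj a b a' b' : conjugate_form a b = conjugate_form a' b' -> a = a' /\ b = b'.
Proof.
move=> E; split.
  have := congr1 (mcoeff (trinom (1, 2, 0)%N)) E.
  rewrite !mcoeffD !mcoeffZ !mcoeffX eqxx !mulr1.
  have -> : (trinom (0, 1, 2) == trinom (1, 2, 0))%N = false.
    by apply/eqP => /mnmP/(_ ord0); rewrite !mnmE.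
  by rewrite !mulr0 !addr0.
have := congr1 (mcoeff (trinom (0, 1, 2)%N)) E.
rewrite !mcoeffD !mcoeffZ !mcoeffX eqxx !mulr1.
have -> : (trinom (1, 2, 0) == trinom (0, 1, 2))%N = false.
  by apply/eqP => /mnmP/(_ ord0); rewrite !mnmE.
by rewrite !mulr0 !add0r.
Qed.

End Conjugates.

Definition low_monomial (r k b : nat) : finType :=
  {a : monomial r.+1 k | (val a ord_max < b)%N}.

Definition low_products (K : fieldType) n r (h : 'I_r.+1 -> {mpoly K[n]}) k b
  (a : low_monomial r k b) : {mpoly K[n]} := mmap1 h (val (val a)).

Section FreeLowProducts.
Variable K : numClosedFieldType.
Local Notation P := {mpoly K[3]}.

Lemma free_low_products k :
  free_family (low_products (cubic_forms (conjugate_form 1 1 : P)) (k := k) (b := 9)).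
Proof.
set g := conjugate_form 1 1; set h := cubic_forms g => c c0.
have [z pz] := primitive_cube_root K; have z3 := prim_expr_order pz.
pose cub (a : low_monomial 3 k 9) : 'X_{1..3} :=
  let m := val (val a) in [multinom 3 * m (widen_ord (leqnSn 3) i) | i < 3]%N.
have hE a : low_products h a = 'X_[cub a] * g ^+ (val (val a)) ord_max.
  rewrite /low_products /mmap1 big_ord_recr /= /h /cubic_forms unlift_none.
  congr (_ * _); rewrite [RHS]mpolyXE_id; apply: eq_bigr => i _.
  have -> : widen_ord (leqnSn 3) i = lift ord_max i by apply/val_inj/esym/lift_max.
  rewrite liftK -exprM !mnmE; congr (_ ^+ (3 * _)).
  by congr (_ _); apply/val_inj/lift_max.
(* The relation is grouped by powers of [g]: its coefficients [C j] are polynomials in the cubes of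
   the variables, hence invariant under [twist] by cube roots of unity. *)
pose C j : P := \sum_(a : low_monomial 3 k 9 | val (val a) ord_max == j) c a *: 'X_[cub a].
pose Q := \poly_(j < 9) C j.
have QE p : Q.[p] = \sum_a c a *: ('X_[cub a] * p ^+ (val (val a)) ord_max).
  rewrite horner_poly (partition_big (fun a : low_monomial 3 k 9 =>
    inord (val (val a) ord_max) : 'I_9) predT) //=.
  apply: eq_bigr => j _; rewrite big_distrl; apply: eq_big => [a|a /eqP <-] /=.
    rewrite -val_eqE /= inordK //; exact: (valP a).
  by rewrite scalerAl.
pose rho (x : 'I_3 * 'I_3) := conjugate_form (z ^+ x.1) (z ^+ x.2).
have rootQ x : root Q (rho x).
  (* For x = (s, t), these weights scale xy^2 by z^(s + 3t) = z^s and yz^2 by z^t. *)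
  pose w : 'I_3 -> K := fun i => tnth [tuple z ^+ (x.1 + x.2); z ^+ x.2; 1] i.
  have w3 i : w i ^+ 3 = 1.
    rewrite /w; case: i => -[|[|[|//]]] i; rewrite (tnth_nth 0) /= ?expr1n //.
      by rewrite exprAC z3 expr1n.
    by rewrite exprAC z3 expr1n.
  have tcub a : twist w 'X_[cub a] = 'X_[cub a].
    rewrite twistX big1 ?scale1r // => i _.
    by rewrite mnmE exprM w3 expr1n.
  have tg : twist w g = rho x.
    rewrite /g /conjugate_form /twist rmorphD /= !comp_mpolyZ !scale1r -!/(twist _ _).
    rewrite !twistX !big_ord_recl !big_ord0 !mnmE /w !(tnth_nth 0) /=.
    rewrite !expr0 !expr1 !expr1n !mulr1 !mul1r; congr (_ *: _ + _).
    by rewrite exprD -mulrA -exprS exprAC z3 expr1n mulr1.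
  have := congr1 (twist w) c0; rewrite /twist raddf0 raddf_sum /= => c0'.
  rewrite /root QE -[X in _ == X]c0'; apply/eqP; apply: eq_bigr => a _.
  by rewrite comp_mpolyZ hE rmorphM rmorphXn /= -!/(twist _ _) tcub tg.
have rho_inj : injective rho.
  move=> [s t] [s' t'] /conjugate_form_inj /= [/eqP + /eqP].
  rewrite !(eq_prim_root_expr pz) !modn_small // => /eqP ss /eqP tt.
  by congr (_, _); apply: val_inj.
(* [Q] has size at most 9 but nine distinct roots. *)
have Q0 : Q = 0.
  apply/eqP; apply: contraT => nQ.
  have := @max_poly_roots _ Q [seq rho x | x in {: 'I_3 * 'I_3}] nQ.
  rewrite map_inj_uniq ?enum_uniq // size_map -cardE card_prod !card_ord.
  move=> /(_ _ isT); rewrite ltnNge size_poly; apply.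
  by apply/allP => _ /mapP[x _ ->].
(* An exponent is determined by its last entry and [cub], so each [c a] is a single coefficient of
   some [C j]. *)
move=> a; have a9 : (val (val a) ord_max < 9)%N := valP a.
have : (Q`_(val (val a) ord_max))@_(cub a) = 0 by rewrite Q0 coef0 mcoeff0.
rewrite coef_poly a9 /C raddf_sum (bigD1 a) //= mcoeffZ mcoeffX eqxx mulr1.
rewrite big1 ?addr0 // => b /andP[/eqP ba nba]; rewrite mcoeffZ mcoeffX.
case: eqP => [/mnmP E|_]; last by rewrite mulr0.
have {}E j : val (val b) (widen_ord (leqnSn 3) j) = val (val a) (widen_ord (leqnSn 3) j).
  by have := E j; rewrite !mnmE => /eqP; rewrite eqn_pmul2l // => /eqP.
case/negP: nba; apply/eqP/val_inj/val_inj.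
have {}ba : val (val b) ord_max = val (val a) ord_max := ba.
move: (val (val b)) (val (val a)) ba E => y x yx E; apply/mnmP => i.
have [j ->|->] := unliftP ord_max i; last exact: yx.
by have <- : widen_ord (leqnSn 3) j = lift ord_max j by apply/val_inj/esym/lift_max.
Qed.

End FreeLowProducts.

(** * The relation of degree 9 *)

Section Veronese.
Variable K : fieldType.
Local Notation P := {mpoly K[3]}.

(* In a monomial of degree divisible by 3 with exponents at most 2, the first two
   exponents determine the third. *)
Definition small_monomial (x : 'I_3 * 'I_3) : 'X_{1..3} :=
  trinom (x.1 : nat, x.2 : nat, (2 * (x.1 + x.2)) %% 3)%N.

Definition first_forms (h : 'I_4 -> P) (j : 'I_3) : P := h (widen_ord (leqnSn 3) j).

(** A small monomial of the wrong degree is replaced by 0, which keeps all nine in the index type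
    for every [d]. *)
Definition veronese_family (h : 'I_4 -> P) d
    (x : ('I_3 * monomial 3 (3 * d)) + ('I_3 * 'I_3)) : P :=
  match x with
  | inl (j, m) => first_forms h j * 'X_[val m]
  | inr y => if mdeg (small_monomial y) == (3 * d.+1)%N then 'X_[small_monomial y] else 0
  end.
Arguments veronese_family : clear implicits.

Definition veronese_spanning (h : 'I_4 -> P) d : Prop :=
  forall p, p \is (3 * d.+1).-homog -> in_span (veronese_family h d) p.

Lemma veronese_homog h d x : (forall j, h j \is 3.-homog) ->
  veronese_family h d x \is (3 * d.+1).-homog.
Proof.
move=> hh; case: x => [[j m]|y] /=.
  rewrite mulnS; apply: dhomogM; first exact: hh.
  by rewrite dhomogX; apply/eqP/mdeg_monomial.
by case: ifP => [dy|_]; [rewrite dhomogX|apply: dhomog0].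
Qed.

(** A monomial is divisible by a cube or has all exponents at most 2. The 0 is a placeholder, as the
    family is built from the first three forms. *)
Lemma veronese_spanning_cubes d : veronese_spanning (cubic_forms 0) d.
Proof.
have cube (m : 'X_{1..3}) i : mdeg m = (3 * d.+1)%N -> (2 < m i)%N ->
    in_span (veronese_family (cubic_forms 0) d) 'X_[m].
  move=> md mi; have le : (U_(i) *+ 3 <= m)%MM.
    apply/mnm_lepP => j; rewrite mulmnE mnm1E; by case: eqP => [<-|].
  have [x xE] : exists x : monomial 3 (3 * d), (m - U_(i) *+ 3)%MM = val x.
    apply: monomialP; apply: (@addIn 3); rewrite addnC -[3 in LHS]mul1n -{1}(mdeg1 i).
    by rewrite -mdegMn addnC -mdegD submK // md mulnS addnC.
  have := in_span_mem (veronese_family (cubic_forms 0) d) (inl (i, x)).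
  rewrite /= /first_forms /cubic_forms.
  have -> : widen_ord (leqnSn 3) i = lift ord_max i by apply/val_inj/esym/lift_max.
  by rewrite liftK mpolyXn -xE -mpolyXD addmC submK.
apply: homog_ind => [|p q|c p|m md].
- exact: in_span0.
- exact: in_spanD.
- exact: in_spanZ.
have [/existsP[i mi]|] := boolP [exists i, (2 < m i)%N]; first exact: cube mi.
rewrite negb_exists => /forallP m2.
have lt3 i : (m i < 3)%N by rewrite ltnNge; apply: m2.
have := in_span_mem (veronese_family (cubic_forms 0) d)
  (inr (Ordinal (lt3 ord0), Ordinal (lt3 (lift ord0 ord0)))).
rewrite /= /small_monomial /=.
(* The total degree is divisible by 3, and 2 is congruent to -1. *)
have -> : (2 * (m ord0 + m (lift ord0 ord0)) %% 3 = m ord_max)%N.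
  move: md (lt3 ord_max); rewrite {1}[m]trinomE mdeg_trinom.
  move: (m _) (m _) (m _) => c b a; clear; lia.
by rewrite -trinomE md eqxx.
Qed.

Variable h : 'I_4 -> P.
Hypothesis hh : forall j, h j \is 3.-homog.
Hypothesis hv : forall d, (d < 3)%N -> veronese_spanning h d.

Local Notation h3 := (first_forms h).
Definition first_eval (c : {mpoly K[3]}) : P := c \mPo [tuple h3 j | j < 3].
HB.instance Definition _ := GRing.RMorphism.copy first_eval
  (comp_mpoly [tuple h3 j | j < 3]).

Lemma first_evalX a : first_eval 'X_[a] = mmap1 h3 a.
Proof.
rewrite /first_eval comp_mpolyX; apply: eq_bigr => j _.
by rewrite tnth_mktuple.
Qed.

(** Small monomials have degree at most 6, so in degree 9, the case d = 2 of [hv], the three forms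
    alone generate everything; this persists in higher degrees. *)
Lemma spanning_first e : (6 <= e)%N -> spanning 3 h3 1 e.
Proof.
move=> e6; apply: (spanning1_ge e6) => p /(hv (d := 2) isT)[c ->].
apply: in_span_sum => -[[j m]|y] _; apply: in_spanZ => /=; last first.
  case: eqP => [|_]; last exact: in_span0.
  case: y => a b; rewrite mdeg_trinom /=.
  by have := ltn_ord a; have := ltn_ord b; have := @ltn_pmod (2 * (a + b)) 3 isT; lia.
rewrite -[h3 j](mmap1U h3); apply: in_span_products; first exact: mdeg1.
by rewrite dhomogX; apply/eqP/mdeg_monomial.
Qed.

Definition small_span (p : P) : Prop :=
  exists c : 'I_3 * 'I_3 -> {mpoly K[3]},
    p = \sum_x first_eval (c x) * 'X_[small_monomial x].

Lemma small_span0 : small_span 0.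
Proof. by exists (fun=> 0); rewrite big1 // => x _; rewrite rmorph0 mul0r. Qed.

Lemma small_spanD p q : small_span p -> small_span q -> small_span (p + q).
Proof.
move=> [a ->] [b ->]; exists (fun x => a x + b x); rewrite -big_split.
by apply: eq_bigr => x _; rewrite rmorphD mulrDl.
Qed.

Lemma small_spanM c p : small_span p -> small_span (first_eval c * p).
Proof.
move=> [a ->]; exists (fun x => c * a x); rewrite big_distrr.
by apply: eq_bigr => x _; rewrite rmorphM /= mulrA.
Qed.

Lemma small_spanZ c p : small_span p -> small_span (c *: p).
Proof.
rewrite -mul_mpolyC -[c%:MP](comp_mpolyC c [tuple h3 j | j < 3]).
exact: small_spanM.
Qed.

Lemma small_span_sum I (r : seq I) (F : I -> P) :
  (forall i, small_span (F i)) -> small_span (\sum_(i <- r) F i).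
Proof.
by move=> sF; elim/big_ind: _ => //; [apply: small_span0|apply: small_spanD].
Qed.

Lemma small_span_monomial x : small_span 'X_[small_monomial x].
Proof.
exists (fun y => if y == x then 1 else 0); rewrite (bigD1 x) //= eqxx rmorph1 mul1r.
by rewrite big1 ?addr0 // => y /negbTE->; rewrite rmorph0 mul0r.
Qed.

(** Each step of the induction extracts one of the first three forms and lowers the degree of the
    cofactor by 3. The step comes from [hv] up to degree 9 and from [spanning_first] beyond. *)
Lemma veronese_small_span d p : p \is (3 * d).-homog -> small_span p.
Proof.
elim: d p => [|d IH] p hp.
  have s1 : small_span 1.
    have := small_span_monomial (ord0, ord0).
    rewrite (_ : small_monomial _ = 0%MM) ?mpolyX0 //.
    by apply/eqP; rewrite -mdeg_eq0 mdeg_trinom.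
  move: p hp; apply: homog_ind => [|p q|c p|m].
  - exact: small_span0.
  - exact: small_spanD.
  - exact: small_spanZ.
  by rewrite muln0 => /eqP; rewrite mdeg_eq0 => /eqP->; rewrite mpolyX0.
have IHm (m : monomial 3 (3 * d)) : small_span 'X_[val m].
  by apply: IH; rewrite dhomogX; apply/eqP/mdeg_monomial.
have [d3|d3] := ltnP d 3.
  have [c ->] := hv d3 hp; apply: small_span_sum => -[[j m]|y]; apply: small_spanZ => /=.
    by rewrite -[h3 j](mmap1U h3) -first_evalX; apply/small_spanM/IHm.
  by case: ifP => _; [apply: small_span_monomial|apply: small_span0].
have e6 : (6 <= 3 * d)%N by clear -d3; lia.
have [|c ->] := spanning_first e6 (p := p); first by rewrite -mulnDr add1n.
apply: small_span_sum => -[a m]; apply: small_spanZ.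
by rewrite /products -first_evalX; apply/small_spanM/IHm.
Qed.

End Veronese.

Lemma in_span_low_products (K : fieldType) n r (h : 'I_r.+1 -> {mpoly K[n]}) k b
    (a : 'X_{1..r.+1}) : mdeg a = k -> (a ord_max < b)%N ->
  in_span (low_products h (k := k) (b := b)) (mmap1 h a).
Proof.
move=> /monomialP[x ->] xb.
exact: (in_span_mem (low_products h (k := k) (b := b)) (Sub x xb)).
Qed.

Section IntegralEquation.
Variable K : fieldType.
Local Notation P := {mpoly K[3]}.
Variable h : 'I_4 -> P.
Hypothesis hh : forall j, h j \is 3.-homog.
Hypothesis hv : forall d, (d < 3)%N -> veronese_spanning h d.
Local Notation g := (h ord_max).
Local Notation ev := (first_eval h).

Lemma integral_equation :
  exists c : 'I_9 -> {mpoly K[3]}, g ^+ 9 = \sum_j ev (c j) * g ^+ j.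
Proof.
pose N := #|{: 'I_3 * 'I_3}|; have N9 : N = 9 by rewrite /N card_prod card_ord.
pose e (i : 'I_N) : P := 'X_[small_monomial (enum_val i)].
have /fin_all_exists[a aE] : forall i : 'I_N, exists c : 'I_N -> {mpoly K[3]},
    g * e i = \sum_j ev (c j) * e j.
  move=> i; have [c cE] : small_span h (g * e i).
    apply: (veronese_small_span hv (d := (mdeg (small_monomial (enum_val i)) %/ 3).+1)).
    rewrite mulnS; apply: dhomogM; first exact: hh.
    rewrite dhomogX /= mdeg_trinom; set x := enum_val i.
    by clear; lia.
  exists (fun j => c (enum_val j)); rewrite cE (reindex_onto enum_val enum_rank) /=.
    by apply: eq_bigl => j; rewrite enum_valK eqxx.
  by move=> x _; rewrite enum_rankK.
pose A : 'M[{mpoly K[3]}]_N := \matrix_(i, j) a i j.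
pose B : 'M[P]_N := map_mx ev A; pose E : 'cV[P]_N := \col_i e i.
have BE : (g%:M - B) *m E = 0.
  apply/colP => i; rewrite mulmxBl mul_scalar_mx !mxE aE; apply/eqP; rewrite subr_eq0; apply/eqP.
  by apply: eq_bigr => j _; rewrite !mxE.
have det0 : \det (g%:M - B) = 0.
  have := congr1 (mulmx (\adj (g%:M - B))) BE.
  (* The determinant annihilates every entry of [E], and the entry at (0, 0) is the monomial 1. *)
  rewrite mulmx0 mulmxA mul_adj_mx mul_scalar_mx => /colP/(_ (enum_rank (ord0, ord0))).
  rewrite !mxE /e enum_rankK (_ : small_monomial _ = 0%MM) ?mpolyX0 ?mulr1 //.
  by apply/eqP; rewrite -mdeg_eq0 mdeg_trinom.
have root_g : (char_poly B).[g] = 0.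
  rewrite -det0 -[LHS]/(horner_eval g _) -det_map_mx; congr (\det _).
  apply/matrixP => i j; rewrite !mxE /= /horner_eval hornerD hornerN hornerC.
  by rewrite hornerMn hornerX.
have szB : size (char_poly B) = 10 by rewrite size_char_poly N9.
move: root_g; rewrite horner_coef szB big_ord_recr /=.
have -> : (char_poly B)`_9 = 1.
  by have /monicP := char_poly_monic B; rewrite /lead_coef szB.
rewrite mul1r addrC => /eqP; rewrite addr_eq0 => /eqP ->.
exists (fun j => - (char_poly A)`_j); rewrite -sumrN; apply: eq_bigr => j _.
rewrite rmorphN mulNr; congr (- (_ * _)).
by rewrite /B -map_char_poly coef_map.
Qed.

(** In the component of degree 27 of the integral equation only products of exactly nine forms
    survive. *)
Lemma low_products_pow9 : in_span (low_products h (k := 9) (b := 9)) (g ^+ 9).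
Proof.
have hg : g ^+ 9 \is 27.-homog by apply: (dhomogMn 9 (hh _)).
have [c cE] := integral_equation.
rewrite -(pihomog_dE hg) cE linear_sum; apply: in_span_sum => j _.
rewrite [c j]mpolyE raddf_sum big_distrl linear_sum; apply: in_span_sum => m _ /=.
pose a : 'X_{1..4} := [multinom [tuple of rcons m j]].
have aE : mmap1 h a = mmap1 (first_forms h) m * g ^+ j.
  rewrite /mmap1 big_ord_recr /= (mnm_nth 0%N) /= nth_rcons size_tuple ltnn eqxx.
  congr (_ * _); apply: eq_bigr => i _.
  by rewrite /first_forms [a _](mnm_nth 0%N) /= nth_rcons size_tuple ltn_ord -mnm_nth.
rewrite -mul_mpolyC rmorphM /= [ev _%:MP]comp_mpolyC mul_mpolyC -scalerAl linearZ.
apply: in_spanZ; rewrite first_evalX -aE /=.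
have [a9|a9] := eqVneq (mdeg a) 9.
  rewrite pihomog_dE; last by have := mmap1_homog hh a; rewrite a9.
  apply: in_span_low_products; first exact: a9.
  by rewrite (mnm_nth 0%N) /= nth_rcons size_tuple ltnn eqxx ltn_ord.
rewrite (pihomog_ne0 _ (mmap1_homog hh a)); first exact: in_span0.
by apply: contra a9 => /eqP a27; rewrite -(eqn_pmul2l (isT : (0 < 3)%N)) a27.
Qed.

(** One more factor raises the last exponent to at most 9. If 9 is reached, [low_products_pow9]
    rewrites g^9, and the rest [d] of the exponent has last entry 0, so the bound is restored at
    once. *)
Lemma low_products_spanning k a : mdeg a = k ->
  in_span (low_products h (k := k) (b := 9)) (mmap1 h a).
Proof.
elim: k a => [|k IH] a.
  move=> /eqP; rewrite mdeg_eq0 => /eqP ->; apply: in_span_low_products.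
    exact: mdeg0.
  by rewrite mnm0E.
case/mnm_pred=> j [b [-> /IH[c cE]]]; rewrite mmap1D mmap1U cE big_distrr.
apply: in_span_sum => x _ /=; rewrite -scalerAr; apply: in_spanZ.
have -> : h j * low_products h x = mmap1 h (U_(j) + val (val x))%MM.
  by rewrite mmap1D mmap1U.
move: (mdeg_monomial (val x)) (valP x : (val (val x) ord_max < 9)%N).
move: (val (val x)) => y yk y9 {c cE x}.
have [low|high] := ltnP ((U_(j) + y)%MM ord_max) 9.
  by apply: in_span_low_products => //; rewrite mdegD mdeg1 yk.
have le : (U_(ord_max) *+ 9 <= U_(j) + y)%MM.
  apply/mnm_lepP => i; rewrite mulmnE mnm1E; case: eqP => [<-|//].
  by rewrite mul1n.
have [d dE] : exists d, (U_(j) + y = d + U_(ord_max) *+ 9)%MM.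
  by exists (U_(j) + y - U_(ord_max) *+ 9)%MM; rewrite submK.
have dk : (mdeg d + 9 = k.+1)%N.
  have := congr1 mdeg dE.
  by rewrite mdegD [in RHS]mdegD mdegMn !mdeg1 yk mul1n add1n => ->.
have d0 : d ord_max = 0%N.
  have := congr1 (fun m : 'X_{1..4} => m ord_max) dE.
  rewrite mnmDE [in RHS]mnmDE mulmnE !mnm1E eqxx mul1n.
  by move: (y ord_max) (d ord_max) y9; clear; case: (j == ord_max) => /= ? ?; lia.
have pow9 : mmap1 h (U_(ord_max) *+ 9)%MM = g ^+ 9.
  rewrite /mmap1 (bigD1 ord_max) //= mulmnE mnm1E eqxx mul1n big1 ?mulr1 // => i.
  by rewrite mulmnE mnm1E eq_sym => /negbTE->; rewrite mul0n expr0.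
have [f fE] := low_products_pow9.
rewrite dE mmap1D pow9 fE big_distrr; apply: in_span_sum => x _ /=.
have -> : mmap1 h d * (f x *: low_products h x) = f x *: mmap1 h (d + val (val x))%MM.
  by rewrite mmap1D scalerAr.
apply: in_spanZ; apply: in_span_low_products.
  by rewrite mdegD mdeg_monomial.
by rewrite mnmDE d0; apply: (valP x).
Qed.

End IntegralEquation.

(** * Counting exponents with bounded last entry *)

Lemma card_low_monomial_small r k b : (k < b)%N ->
  #|{: low_monomial r k b}| = 'C(k + r, r).
Proof.
move=> kb; rewrite card_sig -(@card_monomial r k); apply: eq_card => a.
have ak : (val a ord_max <= k)%N.
  apply: (@leq_trans (mdeg (val a))); last by rewrite mdeg_monomial.
  by rewrite mdegE (bigD1 ord_max) //= leq_addr.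
by rewrite !inE (leq_ltn_trans ak kb).
Qed.

(** Adding b to the last entry identifies the exponents of degree k - b with the excluded ones of
    degree k. *)
Lemma card_low_monomial r k b : (b <= k)%N ->
  (#|{: low_monomial r k b}| + 'C(k - b + r, r) = 'C(k + r, r))%N.
Proof.
move=> bk; rewrite card_sig -!(@card_monomial r).
rewrite -[RHS](cardC [pred a : monomial r.+1 k | (val a ord_max < b)%N]).
congr (_ + _)%N.
have sh (a : monomial r.+1 (k - b)) : (U_(ord_max) *+ b + val a)%MM \in
    [seq s2m (val t) | t <- enum (basis r.+1 k)].
  by rewrite -basis_cover mdegD mdegMn mdeg1 mul1n mdeg_monomial subnKC.
pose phi a : monomial r.+1 k := SeqSub (sh a).
have phi_inj : injective phi.
  by move=> a c E; apply/val_inj/(@addmI _ (U_(ord_max) *+ b)%MM)/(congr1 val E).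
rewrite -(card_codom phi_inj); apply: eq_card => m; rewrite !inE -leqNgt.
apply/codomP/idP => [[a ->]|bm] /=.
  by rewrite mnmDE mulmnE mnm1E eqxx mul1n leq_addr.
have le : (U_(ord_max) *+ b <= val m)%MM.
  apply/mnm_lepP => i; rewrite mulmnE mnm1E; case: eqP => [<-|//].
  by rewrite mul1n.
have [a aE] : exists a : monomial r.+1 (k - b), (val m - U_(ord_max) *+ b)%MM = val a.
  apply: monomialP; apply: (@addIn b); rewrite subnK //.
  by rewrite -[X in (_ + X)%N]mul1n -(mdeg1 (@ord_max r)) -mdegMn -mdegD submK ?mdeg_monomial.
by exists a; apply: val_inj; rewrite /= -aE addmC submK.
Qed.

(** * Hilbert series *)

Lemma geometric_series3 i : series_exp geometric_series 3 i = ('C(i + 2, 2))%:Z.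
Proof.
have one_sum j : series_mul geometric_series (series_of_poly 1) j = 1.
  rewrite /series_mul big_ord_recr /= big1 => [|l _].
    by rewrite /series_of_poly /geometric_series subnn coef1 mulr1 add0r.
  rewrite /series_of_poly coef1 subn_eq0 leqNgt ltn_ord mulr0.
  by [].
have two_sum j :
    series_mul geometric_series (series_mul geometric_series (series_of_poly 1)) j =
    (j.+1)%:Z.
  rewrite [LHS]/series_mul (eq_bigr (fun=> 1)) => [|l _]; last by rewrite one_sum.
  by rewrite sumr_const card_ord -natz.
transitivity (\sum_(j < i.+1) ((i - j).+1)%:Z).
  rewrite /series_exp /= [LHS]/series_mul; apply: eq_bigr => j _.
  by rewrite two_sum mul1r.
elim: i => [|i IH]; first by rewrite big_ord_recl big_ord0 addr0 subn0.
rewrite big_ord_recl /= subn0; under eq_bigr => j _ do rewrite /bump /= subSS.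
by rewrite IH addSn [in RHS]binS bin1 addn2 PoszD addrC.
Qed.

(** Modulo X^(2m) the binomial expansion stops after two terms. *)
Lemma coef_one_sub_Xn_pow m N j : (0 < m)%N -> (j < 2 * m)%N ->
  ((1 - 'X^m : {poly int}) ^+ N)`_j = (j == 0%N)%:R - (j == m)%:R *+ N.
Proof.
move=> m0 jm; have [q ->] : exists q : {poly int},
    (1 - 'X^m) ^+ N = 1 - 'X^m *+ N + 'X^(2 * m) * q.
  elim: N => [|N [q E]]; first by exists 0; rewrite expr0 mulr0n subr0 mulr0 addr0.
  exists (q * (1 - 'X^m) + N%:R); rewrite exprSr E mul2n -addnn exprD.
  set X := 'X^m; rewrite mulrS -[X *+ N]mulr_natl; set c := N%:R; ring.
rewrite coefD coefB coefMn coef1 coefXn coefXnM jm addr0.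
by [].
Qed.

(** For m = 3k this range reaches the truncation point, which is at most 3k + 2 and hence below
    6k. *)
Lemma hilbert_series_coef m N i : (0 < m)%N -> (i < 2 * m)%N ->
  series_mul (series_of_poly ((1 - 'X^m) ^+ N)) (series_exp geometric_series 3) i =
  ('C(i + 2, 2))%:Z - (if (m <= i)%N then ('C(i - m + 2, 2) * N)%:Z else 0).
Proof.
move=> m0 im; rewrite /series_mul /series_of_poly.
under eq_bigr => j _.
  rewrite geometric_series3 coef_one_sub_Xn_pow //; last first.
    exact: leq_ltn_trans (leq_ord j) im.
  rewrite mulrBl; over.
rewrite /= sumrB; congr (_ - _).
  by rewrite big_ord_recl /= mul1r subn0 big1 ?addr0.
case: leqP => mi; last first.
  rewrite big1 // => j _; rewrite ltn_eqF ?mulr0n ?mul0rn ?mul0r //.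
  exact: leq_ltn_trans (leq_ord j) mi.
have mi1 : (m < i.+1)%N by [].
rewrite (bigD1 (Ordinal mi1)) //= eqxx big1 => [|j].
  by rewrite addr0 mulr_natl PoszM -[Posz N]natz mulr_natr.
by rewrite -val_eqE /= => /negbTE->; rewrite mulr0n mul0rn mul0r.
Qed.

(** * Dimensions of the graded pieces *)

Section HilbertFunction.
Variable K : fieldType.
Local Notation P := {mpoly K[3]}.
Variables (h : 'I_4 -> P) (k : nat) (J : idealr P).
Hypothesis hh : forall j, h j \is 3.-homog.
Hypothesis JP : forall p, p \in J <-> pow_span h k p.
Hypothesis s12 : spanning 3 h 1 2.
Hypothesis s41 : spanning 3 h 4 1.
Hypothesis hv : forall d, (d < 3)%N -> veronese_spanning h d.
Hypothesis low_rank :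
  (#|{: low_monomial 3 k 9}| <= family_rank (3 * k) (low_products h (k := k) (b := 9)))%N.

Local Notation dimension i := (has_dimension (@graded_piece K 3 J i)).

Lemma dimension_below i : (i < 3 * k)%N -> dimension i 'C(i + 2, 2).
Proof.
(* Below degree 3k the ideal contains only the zero form, the span of the empty family. *)
move=> ik; pose u (x : void) : P := 0.
have uE : family_rank i u = 0%N.
  by have := family_rank_le_card i u; rewrite card_void leqn0 => /eqP.
have -> : 'C(i + 2, 2) = (#|{: monomial 3 i}| - family_rank i u)%N.
  by rewrite uE subn0 card_monomial.
apply: graded_dimension => [[]//|p hp]; rewrite JP; split=> [pJ|[c ->]].
  by rewrite (pow_span_homog_low hh ik hp pJ); apply: in_span0.
by rewrite big1 => [|[]//]; apply: pow_span0.
Qed.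

Lemma dimension_above e :
  dimension (3 * k + e)
    ('C(3 * k + e + 2, 2) - family_rank (3 * k + e) (products h (k := k) (e := e))).
Proof.
have := graded_dimension (products_homog hh (k := k) (e := e)).
rewrite card_monomial; apply=> p hp.
by rewrite JP; apply: pow_span_homogP.
Qed.

Lemma dimension_spanning e : spanning 3 h k e -> dimension (3 * k + e) 0.
Proof.
move/(span_allP (@products_homog _ _ _ _ _ hh k e)) => sE.
by have := dimension_above e; rewrite sE card_monomial subnn.
Qed.

Lemma dimension_ge2 e : (2 <= e)%N -> dimension (3 * k + e) 0.
Proof. by move=> e2; apply: dimension_spanning; apply: spanning_ge s12. Qed.

Lemma dimension_1 : (4 <= k)%N -> dimension (3 * k + 1) 0.
Proof. by move=> k4; apply: dimension_spanning; apply: spanning_ge2 s12 s41. Qed.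

Lemma dimension_1_small : (k <= 4)%N ->
  dimension (3 * k + 1) ('C(3 * k + 3, 2) - 3 * 'C(k + 3, 3)).
Proof.
move=> k4; have := dimension_above 1.
have /(free_familyP (@products_homog _ _ _ _ _ hh k 1))-> := free_products_linear hh s41 k4.
by rewrite card_prod !card_monomial (_ : 'C(1 + 2, 2) = 3)%N // -addnA [(_ * 3)%N]mulnC.
Qed.

Lemma dimension_0 :
  dimension (3 * k + 0) ('C(3 * k + 2, 2) - #|{: low_monomial 3 k 9}|).
Proof.
have := dimension_above 0; rewrite [X in 'C(X + 2, 2)]addn0.
suff -> : family_rank (3 * k + 0) (products h (k := k) (e := 0)) =
    #|{: low_monomial 3 k 9}| by [].
have lh a : low_products h (k := k) (b := 9) a \is (3 * k + 0).-homog.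
  have := mmap1_homog hh (val (val a)); rewrite mdeg_monomial addn0.
  by [].
apply/eqP; rewrite eqn_leq; apply/andP; split.
  apply: leq_trans (family_rank_le_card (3 * k + 0) (low_products h (k := k) (b := 9))).
  apply: (family_rank_span (products_homog hh (e := 0)) lh) => -[a m].
  rewrite /products /= (_ : val m = 0%MM) ?mpolyX0 ?mulr1.
    by apply: (low_products_spanning hh hv); apply: mdeg_monomial.
  by apply/eqP; rewrite -mdeg_eq0 mdeg_monomial.
apply: leq_trans low_rank _; rewrite -[X in family_rank X]addn0.
apply: (family_rank_span lh (products_homog hh (e := 0))) => a.
rewrite /low_products -[mmap1 _ _]mulr1; apply: in_span_products.
  exact: mdeg_monomial.
exact: dhomog1.
Qed.

End HilbertFunction.

(** * Genericity of the four conditions on the forms *)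

Definition good_forms (K : fieldType) k (h : 'I_4 -> {mpoly K[3]}) : Prop :=
  [/\ spanning 3 h 1 2, spanning 3 h 4 1,
      forall d, (d < 3)%N -> veronese_spanning h d
    & (#|{: low_monomial 3 k 9}| <=
         family_rank (3 * k) (low_products h (k := k) (b := 9)))%N].

Section GoodForms.
Variable K : numFieldType.
Local Notation P := {mpoly K[3]}.
Local Notation F := {ffun 'I_4 -> dhomog 3 K 3}.

Lemma polyfun_veronese_family d x :
  polyfun_coefs (fun f : F => veronese_family (form_at f) (d := d) x).
Proof.
case: x => [[j m]|y]; last exact: polyfun_coefs_const.
by apply: polyfun_coefsM; [apply: polyfun_form|apply: polyfun_coefs_const].
Qed.

Lemma generic_veronese_spanning d :
  generic (fun f : F => veronese_spanning (form_at f) d).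
Proof.
have h0 : 0 \is [in K[3], 3.-homog] by apply: dhomog0.
have [f0 f0E] := form_ex (cubic_forms_homog h0).
have s0 : veronese_spanning (form_at f0) d.
  move=> p /veronese_spanning_cubes[c ->]; exists c; apply: eq_bigr => x _.
  by case: x => [[j m]|y] //=; rewrite /first_forms f0E.
move: (generic_family_rank (3 * d.+1) f0 (@polyfun_veronese_family d)).
apply: generic_imply => f.
have fh (g : F) x : veronese_family (form_at g) (d := d) x \is (3 * d.+1).-homog.
  by apply: veronese_homog; apply: form_homog.
have /(span_allP (fh f0))-> := s0 => le; apply/(span_allP (fh f)).
by apply/eqP; rewrite eqn_leq family_rank_le_monomial.
Qed.

Lemma generic_low_rank k (h : 'I_4 -> P) : (forall j, h j \is 3.-homog) ->
    free_family (low_products h (k := k) (b := 9)) ->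
  generic (fun f : F => (#|{: low_monomial 3 k 9}| <=
    family_rank (3 * k) (low_products (form_at f) (k := k) (b := 9)))%N).
Proof.
move=> /form_ex[f0 f0E] fh.
have lh a : low_products (form_at f0) (k := k) (b := 9) a \is (3 * k).-homog.
  by have := mmap1_homog (form_homog f0) (val (val a)); rewrite mdeg_monomial.
have /(free_familyP lh) fr : free_family (low_products (form_at f0) (k := k) (b := 9)).
  move=> c c0; apply: fh; rewrite -[RHS]c0; apply: eq_bigr => a _.
  by congr (_ *: _); apply: mmap1_eq => j; rewrite f0E.
rewrite -fr; apply: generic_family_rank => a.
exact: polyfun_mmap1.
Qed.

(** Each condition has its own witness: fourth form xyz, [quintinomial] or 0, and [h] for the last.
    Nonempty basic open sets intersect, by [genericI]. *)
Lemma generic_good_forms k (h : 'I_4 -> P) : (forall j, h j \is 3.-homog) ->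
    free_family (low_products h (k := k) (b := 9)) ->
  generic (fun f : F => good_forms k (form_at f)).
Proof.
move=> hh hfree.
have h1 : 'X_[trinom (1, 1, 1)%N] \is [in K[3], 3.-homog] by rewrite dhomogX /= mdeg_trinom.
have g12 := generic_spanning (cubic_forms_homog h1) (@spanning_1_2 K).
have g41 := generic_spanning (cubic_forms_homog (quintinomial_homog K)) (@spanning_4_1 K).
have gv := genericI (generic_veronese_spanning 0)
  (genericI (generic_veronese_spanning 1) (generic_veronese_spanning 2)).
move: (genericI (genericI g12 g41) (genericI gv (generic_low_rank hh hfree))).
apply: generic_imply => f [[s12 s41] [[v0 [v1 v2]] lr]]; split=> //.
by case=> [|[|[|]]].
Qed.

End GoodForms.

(** * Numerical identities and truncation *)

Lemma bin3E n : ('C(n + 3, 3) * 6 = (n + 3) * (n + 2) * (n + 1))%N.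
Proof.
have := bin_ffact (n + 3) 3; rewrite (_ : 3`! = 6)%N // => ->.
by rewrite !ffactnS ffactn0 muln1 !addnS !addn0 /= mulnA.
Qed.

Lemma bin2E n : ('C(n + 2, 2) * 2 = (n + 2) * (n + 1))%N.
Proof.
have := bin_ffact (n + 2) 2; rewrite (_ : 2`! = 2)%N // => ->.
by rewrite !ffactnS ffactn0 muln1 !addnS !addn0.
Qed.

Lemma low_monomial_codim k : (9 <= k)%N ->
  ('C(3 * k + 2, 2) + 56 = 27 * k + #|{: low_monomial 3 k 9}|)%N.
Proof.
move=> k9; have := @card_low_monomial 3 k 9 k9; move: #|_| => l.
have := bin3E k; have := bin3E (k - 9)%N; have := bin2E (3 * k)%N.
(* With k = j + 9 the truncated subtraction disappears, and the cubic terms of the two binomial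
   coefficients cancel. *)
rewrite -(subnK k9); move: (k - 9)%N => j; rewrite addnK.
move: 'C(_, 2) 'C(j + 3, 3) 'C(_, 3) => x y z; clear.
move=> Ex Ey Ez E.
rewrite !(mulnDl, mulnDr) in Ex Ey Ez.
lia.
Qed.

(** These are the signs of the coefficients in degrees 3k, 3k + 1 and 3k + 2: the series is cut at
    3k + 2 for k < 4 and at 3k + 1 from k = 4 on, where the coefficient is exactly 0 for k = 4. *)
Lemma small_binomials k : (1 <= k < 9)%N ->
  [/\ 'C(k + 3, 3) < 'C(3 * k + 2, 2),
      k < 4 -> 3 * 'C(k + 3, 3) < 'C(3 * k + 3, 2),
      4 <= k -> 'C(3 * k + 3, 2) <= 3 * 'C(k + 3, 3)
    & 'C(3 * k + 4, 2) <= 6 * 'C(k + 3, 3)]%N.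
Proof.
move=> k19; have : all (fun k => [&& 'C(k + 3, 3) < 'C(3 * k + 2, 2),
    (k < 4) ==> (3 * 'C(k + 3, 3) < 'C(3 * k + 3, 2)),
    (4 <= k) ==> ('C(3 * k + 3, 2) <= 3 * 'C(k + 3, 3))
  & 'C(3 * k + 4, 2) <= 6 * 'C(k + 3, 3)])%N (iota 1 8) by vm_compute.
by move/allP/(_ k); rewrite mem_iota => /(_ k19)/and4P[? /implyP? /implyP? ?].
Qed.

Lemma series_trunc_pos a i :
  (forall j, (j <= i)%N -> 0 < a j) -> series_trunc a i = a i.
Proof.
move=> apos; rewrite /series_trunc; case: ifP => // /negP[].
by apply/forallP => j; apply: apos; rewrite -ltnS.
Qed.

Lemma series_trunc_nonpos a i j : (j <= i)%N -> a j <= 0 -> series_trunc a i = 0.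
Proof.
move=> ji aj; rewrite /series_trunc; case: ifP => // /forallP/(_ (Ordinal (ji : j < i.+1)%N)).
by rewrite /= Order.POrderTheory.le_gtF.
Qed.

Section HilbertSeries.
Variable K : fieldType.
Local Notation P := {mpoly K[3]}.
Variables (h : 'I_4 -> P) (k : nat) (J : idealr P).
Hypothesis hh : forall j, h j \is 3.-homog.
Hypothesis JP : forall p, p \in J <-> pow_span h k p.
Hypothesis good : good_forms k h.
Hypothesis k_gt0 : (1 <= k)%N.

Lemma hilbert_series_large : (9 <= k)%N ->
  has_hilbert_series J
    (series_of_poly
      (\sum_(0 <= i < 3 * k) ('C(i + 2, 2))%:Z *: 'X^i
       + (27 * k%:Z - 56) *: 'X^(3 * k))).
Proof.
case: good => s12 s41 hv lr k9 i.
rewrite /series_of_poly big_mkord -(poly_def _ (fun i => ('C(i + 2, 2))%:Z)).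
rewrite coefD coef_poly coefZ coefXn; case: ltnP => ik.
  exists 'C(i + 2, 2); first exact: dimension_below hh JP _ ik.
  by rewrite ltn_eqF // mulr0 addr0.
rewrite add0r -(subnKC ik); case: (i - 3 * k)%N => [|[|e]].
- exists ('C(3 * k + 2, 2) - #|{: low_monomial 3 k 9}|)%N.
    exact: dimension_0 hh JP hv lr.
  rewrite addn0 eqxx mulr1; have := low_monomial_codim k9.
  by move: 'C(_, _) #|_| k9 => x y; clear; lia.
- exists 0%N; first by apply: dimension_1 hh JP s12 s41 _; apply: leq_trans k9.
  by rewrite -[X in _ == X]addn0 eqn_add2l mulr0.
- exists 0%N; first exact: (dimension_ge2 hh JP s12 (isT : (2 <= e.+2)%N)).
  by rewrite -[X in _ == X]addn0 eqn_add2l mulr0.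
Qed.

Lemma hilbert_series_small : (k < 9)%N ->
  has_hilbert_series J
    (series_trunc
      (series_mul
        (series_of_poly ((1 - 'X^(3 * k)) ^+ 'C(k + 3, 3)))
        (series_exp geometric_series 3))).
Proof.
case: good => s12 s41 hv lr k9 i; set a := series_mul _ _.
have /small_binomials[b0 b1 b1' b2] : (1 <= k < 9)%N by rewrite k_gt0.
have aE e : (e < 3 * k)%N ->
    a (3 * k + e)%N = 'C(3 * k + e + 2, 2)%:Z - ('C(e + 2, 2) * 'C(k + 3, 3))%:Z.
  move=> ek; rewrite /a hilbert_series_coef ?leq_addr ?addKn //.
    by rewrite muln_gt0.
  by rewrite mul2n -addnn ltn_add2l.
have a_below j : (j < 3 * k)%N -> a j = 'C(j + 2, 2).
  move=> jk; rewrite /a hilbert_series_coef; first by rewrite leqNgt jk subr0.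
    by rewrite muln_gt0.
  by rewrite mul2n -addnn ltn_addr.
have k3 e : (e < 3)%N -> (e < 3 * k)%N by move/leq_trans; apply; rewrite leq_pmulr.
have a0 : a (3 * k)%N = 'C(3 * k + 2, 2)%:Z - 'C(k + 3, 3)%:Z.
  by rewrite -[X in a X]addn0 aE ?k3 // addn0 mul1n.
have a1 : a (3 * k + 1)%N = 'C(3 * k + 3, 2)%:Z - (3 * 'C(k + 3, 3))%:Z.
  by rewrite aE ?k3 // -addnA.
have a2 : a (3 * k + 2)%N <= 0.
  by rewrite aE ?k3 // -addnA subr_le0 lez_nat.
have pos_below j : (j < 3 * k)%N -> 0 < a j.
  by move=> jk; rewrite a_below // ltz_nat bin_gt0 leq_addl.
have pos0 j : (j <= 3 * k)%N -> 0 < a j.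
  rewrite leq_eqVlt => /predU1P[->|/pos_below//].
  by rewrite a0 subr_gt0 ltz_nat.
have [ik|ik] := ltnP i (3 * k).
  exists 'C(i + 2, 2); first exact: dimension_below hh JP _ ik.
  by rewrite series_trunc_pos ?a_below // => j ji; apply/pos0/(leq_trans ji)/ltnW.
rewrite -(subnKC ik); case: (i - 3 * k)%N => [|[|e]].
- exists ('C(3 * k + 2, 2) - 'C(k + 3, 3))%N.
    (* For k < 9 every exponent of degree k has last entry below 9, so all products of k forms are
       independent. *)
    by rewrite -(@card_low_monomial_small 3 k 9 k9); apply: dimension_0 hh JP hv lr.
  by rewrite addn0 series_trunc_pos // a0 subzn // ltnW.
(* In degree 3k + 1, the products are independent and leave a positive dimension for k < 4, while
   they fill the whole degree for larger k. *)
- have [k4|k4] := ltnP k 4.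
    exists ('C(3 * k + 3, 2) - 3 * 'C(k + 3, 3))%N.
      exact: dimension_1_small hh JP s41 (ltnW k4).
    rewrite series_trunc_pos ?a1 ?subzn ?(ltnW (b1 k4)) // => j.
    rewrite leq_eqVlt addn1 ltnS => /predU1P[->|/pos0//].
    by rewrite -addn1 a1 subr_gt0 ltz_nat b1.
  exists 0%N; first exact: dimension_1 hh JP s12 s41 k4.
  by rewrite (series_trunc_nonpos (leqnn _)) // a1 subr_le0 lez_nat b1'.
exists 0%N; first exact: (dimension_ge2 hh JP s12 (isT : (2 <= e.+2)%N)).
by rewrite (series_trunc_nonpos _ a2) // leq_add2l.
Qed.

End HilbertSeries.

Theorem theorem10 (R : realType) (k : nat) (k_gt0 : (1 <= k)%N) :
  ((9 <= k <= 40)%N ->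
    for_general (fun f : {ffun 'I_4 -> dhomog 3 R[i] 3} =>
      has_hilbert_series (forms_ideal_pow (ltn0Sn 2) f k_gt0)
        (series_of_poly
          (\sum_(0 <= i < 3 * k) ('C(i + 2, 2))%:Z *: 'X^i
           + (27 * k%:Z - 56) *: 'X^(3 * k)))))
  /\
  ((k < 9)%N ->
    for_general (fun f : {ffun 'I_4 -> dhomog 3 R[i] 3} =>
      has_hilbert_series (forms_ideal_pow (ltn0Sn 2) f k_gt0)
        (series_trunc
          (series_mul
            (series_of_poly ((1 - 'X^(3 * k)) ^+ 'C(k + 3, 3)))
            (series_exp geometric_series 3))))).
Proof.
have hg : conjugate_form 1 1 \is [in R[i][3], 3.-homog].
  by apply: rpredD; apply: rpredZ; rewrite dhomogX /= mdeg_trinom.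
have gen := generic_good_forms (cubic_forms_homog hg) (@free_low_products R[i] k).
have JP (f : {ffun 'I_4 -> dhomog 3 R[i] 3}) p :
    p \in forms_ideal_pow (ltn0Sn 2) f k_gt0 <-> pow_span (form_at f) k p.
  rewrite -ideal_powP; split=> [/asboolP //|pf].
  exact/asboolP.
split=> [/andP[k9 _]|k9]; apply/for_general_generic; apply: generic_imply gen => f gf.
  exact: (hilbert_series_large (form_homog f) (JP f) gf k9).
exact: (hilbert_series_small (form_homog f) (JP f) gf k_gt0 k9).
Qed.
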